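(* Classical NF proves that the set $\mathbb{N}$ of Church numbers is infinite and that Church successor is one-to-one on $\mathbb{N}$ (for all $x,y\in\mathbb{N}$, $\mathsf{S}x=\mathsf{S}y\to x=y$).
   Context: NF (Quine's New Foundations) is the first-order theory with equality over classical logic, with one binary predicate $\in$, whose axioms are extensionality ($\forall z(z\in x\leftrightarrow z\in y)\to x=y$) and stratified comprehension (the set $\{x:\varphi\}$ exists for every stratified $\varphi$, parameters allowed; $\varphi$ is stratified if its variables can be assigned natural-number indices so that in each subformula $x\in y$ the index of $y$ is one more than that of $x$, and in each $x=y$ the indices agree). Ordered pairs are $\langle x,y\rangle=\{\{x\},\{x,y\}\}$. $\mathrm{FUNC}=\{f:\forall x,y,z(\langle x,y\rangle\in f\to\langle x,z\rangle\in f\to y=z)\}$. Application: $Ap(f,x)=\{t:\exists y(\langle x,y\rangle\in f\land t\in y)\}$, so $Ap(f,x)=y$ if $f\in\mathrm{FUNC}$ and $\langle x,y\rangle\in f$. Write $fx$ for $Ap(f,x)$, associating to the left. Church numbers: $\mathbf{0}=\{\langle f,\mathrm{id}\rangle: f=f\}$ with $\mathrm{id}=\{\langle x,x\rangle:x=x\}$. Church successor is the set of all pairs $\langle z,s_z\rangle$ with $z\in\mathrm{FUNC}$, where $s_z$ is the set of all $\langle f,p\rangle$ with $f\in\mathrm{FUNC}$ and $\forall u\,(u\in p\leftrightarrow\exists x,w,t,q\,(u=\langle x,w\rangle\land t\in\mathrm{FUNC}\land\langle f,t\rangle\in z\land\langle x,q\rangle\in t\land\langle q,w\rangle\in f))$;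 it is denoted $\mathsf{S}$. $\mathbb{N}$ is the intersection of all sets containing $\mathbf{0}$ and closed under $\mathsf{S}$. A set $X$ is infinite (Dedekind) if there is $Y\subseteq X$ with $Y\neq X$ and $X\sim Y$, where $X\sim Y$ means that some relation is a one-to-one function from $X$ onto $Y$. *)

(* Defs.v *)
From Stdlib Require Import List.
Import ListNotations.

(** * First-order classical logic with equality, one binary predicate

    Variables are de Bruijn indices.  There are no function symbols, so the
    only terms are variables and substitution is renaming. *)

Inductive form : Type :=
| Bot : form
| Eq  : nat -> nat -> form
| Mem : nat -> nat -> form   (* [Mem i j] is "i belongs to j" *)
| Imp : form -> form -> form
| All : form -> form.

Definition Neg (p : form) : form := Imp p Bot.
Definition And (p q : form) : form := Neg (Imp p (Neg q)).
Definition Or (p q : form) : form := Imp (Neg p) q.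
Definition Iff (p q : form) : form := And (Imp p q) (Imp q p).
Definition Ex (p : form) : form := Neg (All (Neg p)).

Definition scons {A : Type} (a : A) (s : nat -> A) (n : nat) : A :=
  match n with 0 => a | S m => s m end.

Fixpoint ren (r : nat -> nat) (p : form) : form :=
  match p with
  | Bot => Bot
  | Eq i j => Eq (r i) (r j)
  | Mem i j => Mem (r i) (r j)
  | Imp p q => Imp (ren r p) (ren r q)
  | All p => All (ren (scons 0 (fun n => S (r n))) p)
  end.

Definition shift (p : form) : form := ren S p.

(** [inst t p] replaces variable 0 of [p] by the variable [t] and lowers the
    others. *)
Definition inst (t : nat) (p : form) : form := ren (scons t (fun n => n)) p.

(** Natural deduction from the non-logical axioms [T].  Free variables of the
    axioms are read as universally quantified: [T], unlike the list of
    hypotheses, is not shifted in [AllI]. *)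
Inductive prv (T : form -> Prop) : list form -> form -> Prop :=
| Ax     G p     : T p -> prv T G p
| Hyp    G p     : In p G -> prv T G p
| ImpI   G p q   : prv T (p :: G) q -> prv T G (Imp p q)
| ImpE   G p q   : prv T G (Imp p q) -> prv T G p -> prv T G q
| Contra G p     : prv T (Neg p :: G) Bot -> prv T G p
| AllI   G p     : prv T (map shift G) p -> prv T G (All p)
| AllE   G p t   : prv T G (All p) -> prv T G (inst t p)
| EqRefl G t     : prv T G (Eq t t)
| EqSubst G p s t : prv T G (Eq s t) -> prv T G (inst s p) -> prv T G (inst t p).

Definition proves (T : form -> Prop) (p : form) : Prop := prv T [] p.

(** * The theory NF *)

(** [s] gives the indices of the free variables; each bound variable gets an
    index of its own, which is harmless since bound variables may be renamed
    apart. *)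
Fixpoint stratified_by (s : nat -> nat) (p : form) : Prop :=
  match p with
  | Bot => True
  | Eq i j => s i = s j
  | Mem i j => s j = S (s i)
  | Imp p q => stratified_by s p /\ stratified_by s q
  | All p => exists k, stratified_by (scons k s) p
  end.

Definition stratified (p : form) : Prop := exists s, stratified_by s p.

Definition extensionality : form :=
  All (All (Imp (All (Iff (Mem 0 2) (Mem 0 1))) (Eq 1 0))).

(** Existence of [{x : p}], where variable 0 of [p] is [x] and the other free
    variables are the parameters.  The renaming makes room for the variable
    denoting the set, which does not occur in [p]. *)
Definition comprehension (p : form) : form :=
  Ex (All (Iff (Mem 0 1) (ren (scons 0 (fun n => S (S n))) p))).

Inductive NF : form -> Prop :=
| NF_ext : NF extensionality
| NF_comp p : stratified p -> NF (comprehension p).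

(** * Writing formulas with named bound variables

    A [pform] is a formula awaiting the number [d] of enclosing quantifiers.
    A variable is named by its level, that is, by the number of quantifiers
    enclosing its binder; under [d] quantifiers, level [x] is the de Bruijn
    index [d - S x]. *)

Definition var := nat.
Definition pform := nat -> form.

Definition closed_form (p : pform) : form := p 0.

Definition pEq (x y : var) : pform := fun d => Eq (d - S x) (d - S y).
Definition pMem (x y : var) : pform := fun d => Mem (d - S x) (d - S y).
Definition pNeg (p : pform) : pform := fun d => Neg (p d).
Definition pImp (p q : pform) : pform := fun d => Imp (p d) (q d).
Definition pAnd (p q : pform) : pform := fun d => And (p d) (q d).
Definition pOr (p q : pform) : pform := fun d => Or (p d) (q d).
Definition pIff (p q : pform) : pform := fun d => Iff (p d) (q d).
Definition pAll (p : var -> pform) : pform := fun d => All (p d (S d)).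
Definition pEx (p : var -> pform) : pform := fun d => Ex (p d (S d)).

Declare Scope nf_scope.
Delimit Scope nf_scope with nf.
Bind Scope nf_scope with pform.

Notation "x ≐ y" := (pEq x y) (at level 70) : nf_scope.
Notation "x ∈ y" := (pMem x y) (at level 70) : nf_scope.
Notation "¬ p" := (pNeg p) (at level 75, right associativity) : nf_scope.
Notation "p ∧ q" := (pAnd p q) (at level 80, right associativity) : nf_scope.
Notation "p ∨ q" := (pOr p q) (at level 85, right associativity) : nf_scope.
Notation "p ⇒ q" := (pImp p q) (at level 90, right associativity) : nf_scope.
Notation "p ⇔ q" := (pIff p q) (at level 95, no associativity) : nf_scope.
Notation "∀ x .. y , p" := (pAll (fun x => .. (pAll (fun y => p)) ..))
  (at level 200, x binder, y binder, right associativity) : nf_scope.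
Notation "∃ x .. y , p" := (pEx (fun x => .. (pEx (fun y => p)) ..))
  (at level 200, x binder, y binder, right associativity) : nf_scope.

Open Scope nf_scope.

(** * Church numbers in NF

    A defined set term [t] is represented by the formula [a = t], written
    [is_t a], and an atomic formula [A(t)] by [∃ a, is_t a ∧ A(a)]. *)

Definition is_singleton (a x : var) : pform := ∀ t, t ∈ a ⇔ t ≐ x.

Definition is_unordered_pair (a x y : var) : pform :=
  ∀ t, t ∈ a ⇔ t ≐ x ∨ t ≐ y.

Definition is_pair (p x y : var) : pform :=
  ∀ a, a ∈ p ⇔ is_singleton a x ∨ is_unordered_pair a x y.

Definition pair_in (x y f : var) : pform := ∃ p, is_pair p x y ∧ p ∈ f.

Definition FUNC (f : var) : pform :=
  ∀ x y z, pair_in x y f ⇒ pair_in x z f ⇒ y ≐ z.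

Definition is_Ap (a f x : var) : pform :=
  ∀ t, t ∈ a ⇔ ∃ y, pair_in x y f ∧ t ∈ y.

Definition is_id (i : var) : pform := ∀ u, u ∈ i ⇔ ∃ x, is_pair u x x.

Definition is_zero (o : var) : pform :=
  ∀ u, u ∈ o ⇔ ∃ f i, is_id i ∧ is_pair u f i.

(** [s] is the set s_z *)
Definition is_succ_of (s z : var) : pform :=
  ∀ v, v ∈ s ⇔
    ∃ f p, is_pair v f p ∧ FUNC f ∧
      ∀ u, u ∈ p ⇔
        ∃ x w t q, is_pair u x w ∧ FUNC t ∧ pair_in f t z ∧
                   pair_in x q t ∧ pair_in q w f.

(** [S] is the Church successor function *)
Definition is_Succ (S : var) : pform :=
  ∀ v, v ∈ S ⇔ ∃ z s, is_pair v z s ∧ FUNC z ∧ is_succ_of s z.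

Definition contains_zero (X : var) : pform := ∃ o, is_zero o ∧ o ∈ X.

Definition closed_under_succ (X : var) : pform :=
  ∀ m, m ∈ X ⇒ ∃ S a, is_Succ S ∧ is_Ap a S m ∧ a ∈ X.

Definition is_Nat (N : var) : pform :=
  ∀ n, n ∈ N ⇔ ∀ X, contains_zero X ∧ closed_under_succ X ⇒ n ∈ X.

Definition subset (Y X : var) : pform := ∀ t, t ∈ Y ⇒ t ∈ X.

Definition bijection (r X Y : var) : pform :=
  (∀ u, u ∈ r ⇒ ∃ x y, is_pair u x y ∧ x ∈ X ∧ y ∈ Y) ∧
  FUNC r ∧
  (∀ x, x ∈ X ⇒ ∃ y, pair_in x y r) ∧
  (∀ x x' y, pair_in x y r ⇒ pair_in x' y r ⇒ x ≐ x') ∧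
  (∀ y, y ∈ Y ⇒ ∃ x, pair_in x y r).

Definition similar (X Y : var) : pform := ∃ r, bijection r X Y.

Definition infinite (X : var) : pform :=
  ∃ Y, subset Y X ∧ ¬ (Y ≐ X) ∧ similar X Y.

Definition one_to_one_on (S X : var) : pform :=
  ∀ x y, x ∈ X ∧ y ∈ X ⇒ (∃ a, is_Ap a S x ∧ is_Ap a S y) ⇒ x ≐ y.

Definition Nat_infinite_and_Succ_one_to_one : form :=
  closed_form
    (∃ N S, is_Nat N ∧ is_Succ S ∧ infinite N ∧ one_to_one_on S N).

(* Main.v *)
(** The deduction system is complete, so it suffices to argue in an arbitrary
    model of NF.

    There the universe is not finite. If it were, all sets would be finite, so
    that cardinals would be linearly ordered and [P] injective on them. Put
    2^|USC(Z)| = |P(Z)|, where USC(Z) is the set of singletons of elements of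
    Z, and consider the sequence 0, 2^0, 2^(2^0), ... as long as it is defined.
    It has a last term |L|, whose index has a residue modulo 3 that the type
    shift X |-> USC(X) preserves. But the shifted sequence continues with
    2^|USC(L)| = |P(L)|, and either this is the last term, or the next one is,
    being |V|: the index of the last term would be congruent to itself plus 1
    or 2. This is Specker's argument, in a finite universe.

    Hence every finite set can be enlarged, and induction on n in N gives a
    finite function f with f^n nonempty and f^(n+1) empty, by prolonging a path
    by a new point. If Sm = Sn with m < n, such an f for m + 1 is a
    contradiction; and S is never zero, since f^(n+1) is not the identity. *)

From Stdlib Require Import List Lia PeanoNat Classical ClassicalEpsilon
  FunctionalExtensionality PropExtensionality ProofIrrelevance Cantor.
Require Import Defs.
Import ListNotations.

(** * Completeness of the deduction system *)

Lemma ren_ext (r s : nat -> nat) (p : form) :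
  (forall n, r n = s n) -> ren r p = ren s p.
Proof.
  revert r s; induction p as [| | |p IHp q IHq|p IH]; intros r s E; cbn;
    try congruence.
  - now rewrite (IHp r s E), (IHq r s E).
  - f_equal. apply IH. intros [|n]; cbn; congruence.
Qed.

Lemma ren_id (p : form) : ren (fun n => n) p = p.
Proof.
  induction p as [| | |p IHp q IHq|p IH]; cbn; try congruence.
  apply (f_equal All). etransitivity; [|exact IH]. apply ren_ext.
  now intros [|n].
Qed.

Lemma ren_ren (r s : nat -> nat) (p : form) :
  ren r (ren s p) = ren (fun n => r (s n)) p.
Proof.
  revert r s; induction p as [| | |p IHp q IHq|p IH]; intros r s; cbn;
    try reflexivity.
  - now rewrite IHp, IHq.
  - f_equal. rewrite IH. apply ren_ext. now intros [|n].
Qed.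

Fixpoint fv_bound (p : form) : nat :=
  match p with
  | Bot => 0
  | Eq i j | Mem i j => S (Nat.max i j)
  | Imp p q => Nat.max (fv_bound p) (fv_bound q)
  | All p => pred (fv_bound p)
  end.

Lemma ren_ext_bound (r s : nat -> nat) (p : form) :
  (forall n, n < fv_bound p -> r n = s n) -> ren r p = ren s p.
Proof.
  revert r s; induction p as [|i j|i j|p IHp q IHq|p IH]; intros r s E;
    cbn in *.
  - reflexivity.
  - rewrite (E i), (E j) by lia. reflexivity.
  - rewrite (E i), (E j) by lia. reflexivity.
  - rewrite (IHp r s), (IHq r s); auto; intros n Hn; apply E; lia.
  - f_equal. apply IH. intros [|n] Hn; cbn; [reflexivity|].
    rewrite E by lia. reflexivity.
Qed.

Lemma weaken T G p : prv T G p -> forall G', incl G G' -> prv T G' p.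
Proof.
  induction 1 as [G p A|G p A|G p q _ IH|G p q _ IH1 _ IH2|G p _ IH|G p _ IH
                 |G p t _ IH|G t|G p s t _ IH1 _ IH2]; intros G' I.
  - now apply Ax.
  - apply Hyp; auto.
  - apply ImpI, IH. intros x [->|Hx]; [left|right]; auto.
  - eapply ImpE; eauto.
  - apply Contra, IH. intros x [->|Hx]; [left|right]; auto.
  - apply AllI, IH. intros x Hx. apply in_map_iff in Hx as (y & <- & Hy).
    apply in_map; auto.
  - apply AllE; auto.
  - apply EqRefl.
  - eapply EqSubst; eauto.
Qed.

Lemma map_shift_ren (r : nat -> nat) (G : list form) :
  map (ren (scons 0 (fun n => S (r n)))) (map shift G)
  = map shift (map (ren r) G).
Proof.
  rewrite !map_map. apply map_ext. intros p. unfold shift.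
  now rewrite !ren_ren.
Qed.

Lemma ren_inst (r : nat -> nat) (t : nat) (p : form) :
  ren r (inst t p) = inst (r t) (ren (scons 0 (fun n => S (r n))) p).
Proof.
  unfold inst. rewrite !ren_ren. apply ren_ext. now intros [|n].
Qed.

(** Axioms are not shifted in [AllI], so a renamed derivation needs the renamed axioms again; hence
    [Tren]. *)
Lemma prv_ren T (Tren : forall p r, T p -> T (ren r p)) G p :
  prv T G p -> forall r, prv T (map (ren r) G) (ren r p).
Proof.
  induction 1 as [G p A|G p A|G p q _ IH|G p q _ IH1 _ IH2|G p _ IH|G p _ IH
                 |G p t _ IH|G t|G p s t _ IH1 _ IH2]; intros r; cbn in *.
  - now apply Ax, Tren.
  - apply Hyp, in_map; auto.
  - apply ImpI, IH.
  - eapply ImpE; eauto.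
  - apply Contra, IH.
  - apply AllI. rewrite <- map_shift_ren. apply IH.
  - rewrite ren_inst. apply AllE, IH.
  - apply EqRefl.
  - rewrite ren_inst. eapply EqSubst; [apply IH1|].
    rewrite <- ren_inst. apply IH2.
Qed.

(** An arbitrary [T] need not satisfy the hypothesis of [prv_ren]; its closure does, and
    [prv_ren_closure] shows that nothing new becomes provable. *)
Definition ren_closure (T : form -> Prop) (p : form) : Prop :=
  exists q r, T q /\ p = ren r q.

(** The value of variable 0 is instantiated shifted by [n], a shift undone by
    the [n] remaining instantiations. *)
Lemma prv_ren_block T n : forall p r,
  (forall G, prv T G p) -> (forall i, r (n + i) = i) ->
  forall G, prv T G (ren r p).
Proof.
  induction n as [|n IH]; intros p r Hp Hr G.
  - rewrite (ren_ext r (fun n => n)), ren_id by apply Hr. apply Hp.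
  - rewrite (ren_ext r (fun i => r (S (scons (n + r 0) (fun i => i) i)))).
    + rewrite <- (ren_ren (fun i => r (S i))). apply IH; [|intros i; apply Hr].
      intros G'. apply AllE, AllI, Hp.
    + intros [|i]; cbn; [|reflexivity]. symmetry. apply (Hr (r 0)).
Qed.

Lemma prv_ren_closure T G p : prv (ren_closure T) G p -> prv T G p.
Proof.
  induction 1 as [G p A|G p A|G p q _ IH|G p q _ IH1 _ IH2|G p _ IH|G p _ IH
                 |G p t _ IH|G t|G p s t _ IH1 _ IH2].
  - destruct A as (q & r & Hq & ->).
    set (n := fv_bound q).
    (* Above the free variables of [q] the renaming may be changed at will; subtracting [n] there
       gives it the shape that [prv_ren_block] asks for. *)
    rewrite (ren_ext_bound r (fun i => if i <? n then r i else i - n)).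
    + apply prv_ren_block with (n := n); [intros; now apply Ax|].
      intros i. destruct (Nat.ltb_spec (n + i) n); lia.
    + intros i Hi. destruct (Nat.ltb_spec i n); [reflexivity|subst n; lia].
  - now apply Hyp.
  - now apply ImpI.
  - eapply ImpE; eauto.
  - now apply Contra.
  - now apply AllI.
  - now apply AllE.
  - apply EqRefl.
  - eapply EqSubst; eauto.
Qed.

(** * Satisfaction, and an enumeration of the formulas *)

Fixpoint sat {M : Type} (mem : M -> M -> Prop) (e : nat -> M) (p : form)
  : Prop :=
  match p with
  | Bot => False
  | Eq i j => e i = e j
  | Mem i j => mem (e i) (e j)
  | Imp p q => sat mem e p -> sat mem e q
  | All p => forall a, sat mem (scons a e) p
  end.

Fixpoint form_code (p : form) : nat :=
  match p with
  | Bot => to_nat (0, 0)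
  | Eq i j => to_nat (1, to_nat (i, j))
  | Mem i j => to_nat (2, to_nat (i, j))
  | Imp p q => to_nat (3, to_nat (form_code p, form_code q))
  | All p => to_nat (4, form_code p)
  end.

Lemma to_nat_inj (x y : nat * nat) : to_nat x = to_nat y -> x = y.
Proof.
  intros E. now rewrite <- (cancel_of_to x), <- (cancel_of_to y), E.
Qed.

Lemma form_code_inj (p q : form) : form_code p = form_code q -> p = q.
Proof.
  revert q; induction p as [|i j|i j|p1 IH1 p2 IH2|p IH];
    intros [|i' j'|i' j'|q1 q2|q] E; cbn -[to_nat] in E;
    apply to_nat_inj, pair_equal_spec in E as [E0 E];
    try discriminate E0; try reflexivity;
    try (apply to_nat_inj, pair_equal_spec in E as [E1 E2]);
    f_equal; auto.
Qed.

(** Decoding by choice: each formula occurs at its own code, and a number that codes nothing yields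
    an arbitrary formula. *)
Definition form_enum (n : nat) : form :=
  epsilon (inhabits Bot) (fun p => form_code p = n).

Lemma form_enum_onto (p : form) : form_enum (form_code p) = p.
Proof.
  apply form_code_inj. unfold form_enum.
  apply (epsilon_spec (inhabits Bot) (fun q => form_code q = form_code p)).
  now exists p.
Qed.

(** * Henkin's construction, with variables in the role of the new constants *)

Section Henkin.
Context (T : form -> Prop) (Tren : forall p r, T p -> T (ren r p)).

Definition consistent (G : list form) : Prop := ~ prv T G Bot.

Definition fresh (G : list form) (q : form) : nat :=
  fold_right (fun p n => Nat.max (fv_bound p) n) (fv_bound q) G.

Lemma fresh_hyp G q p : In p G -> fv_bound p <= fresh G q.
Proof.
  induction G as [|g G IH]; cbn; intros H; [easy|].
  destruct H as [->|H]; [lia|]. specialize (IH H). unfold fresh in IH. lia.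
Qed.

Lemma fresh_goal G q : fv_bound q <= fresh G q.
Proof.
  induction G as [|g G IH]; cbn in *; [auto|]. unfold fresh in IH. lia.
Qed.

Lemma generalize_fresh G q c :
  (forall p, In p G -> fv_bound p <= c) -> fv_bound q <= c ->
  prv T G (inst c q) -> prv T G (All q).
Proof.
  intros HG Hq H. apply AllI.
  (* [r] turns the fresh variable [c] into the variable about to be bound and shifts all others, so
     it maps [G] to its shift and [inst c q] back to [q]. *)
  set (r := fun n => if n =? c then 0 else S n).
  apply (prv_ren T Tren) with (r := r) in H.
  assert (E : map (ren r) G = map shift G).
  { apply map_ext_in. intros p Hp. apply ren_ext_bound. intros n Hn.
    unfold r. specialize (HG p Hp). destruct (Nat.eqb_spec n c); lia. }
  rewrite E in H. unfold inst in H. rewrite ren_ren in H.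
  rewrite (ren_ext_bound _ (fun n => n)), ren_id in H; [exact H|].
  intros [|n] Hn; unfold r; cbn.
  - now rewrite Nat.eqb_refl.
  - destruct (Nat.eqb_spec n c); lia.
Qed.

(** A rejected universal formula is refuted together with a fresh counterexample, which later
    provides [henkin_witness]. *)
Definition henkin_step (G : list form) (p : form) : list form :=
  if excluded_middle_informative (consistent (p :: G)) then p :: G
  else match p with
       | All q => Neg (inst (fresh (Neg p :: G) q) q) :: Neg p :: G
       | _ => Neg p :: G
       end.

Lemma consistent_neg G p :
  consistent G -> ~ consistent (p :: G) -> consistent (Neg p :: G).
Proof.
  intros HG Hp Hn. apply Hp. intros Hp'. apply HG.
  eapply ImpE; [apply ImpI, Hn|]. apply ImpI, Hp'.
Qed.

Lemma henkin_step_consistent G p :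
  consistent G -> consistent (henkin_step G p).
Proof.
  intros HG. unfold henkin_step.
  destruct excluded_middle_informative as [H|H]; [exact H|].
  pose proof (consistent_neg G p HG H) as Hn.
  destruct p as [|i j|i j|p1 p2|q]; try exact Hn.
  (* If the counterexample were contradictory, the instance at a fresh variable would be provable,
     hence also its generalization, against [Neg (All q)]. *)
  intros F. apply Hn. eapply ImpE; [apply Hyp; now left|].
  apply generalize_fresh with (c := fresh (Neg (All q) :: G) q).
  - intros p. apply fresh_hyp.
  - apply fresh_goal.
  - now apply Contra.
Qed.

Context (G0 : list form) (HG0 : consistent G0).

Fixpoint henkin_stage (n : nat) : list form :=
  match n with
  | 0 => G0
  | S n => henkin_step (henkin_stage n) (form_enum n)
  end.

Definition henkin (p : form) : Prop := exists n, In p (henkin_stage n).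

Lemma henkin_stage_consistent n : consistent (henkin_stage n).
Proof.
  induction n as [|n IH]; cbn; [exact HG0|]. now apply henkin_step_consistent.
Qed.

Lemma henkin_stage_mono n m :
  n <= m -> incl (henkin_stage n) (henkin_stage m).
Proof.
  induction 1 as [|m _ IH]; [apply incl_refl|].
  intros p Hp. apply IH in Hp. cbn. unfold henkin_step.
  destruct excluded_middle_informative; [now right|].
  destruct (form_enum m); cbn; auto.
Qed.

Lemma henkin_finite L :
  (forall p, In p L -> henkin p) -> exists n, incl L (henkin_stage n).
Proof.
  induction L as [|p L IH]; intros H; [exists 0; easy|].
  destruct IH as [n Hn]; [intros q Hq; apply H; now right|].
  destruct (H p (or_introl eq_refl)) as [m Hm].
  exists (Nat.max n m). intros q [<-|Hq].
  - revert Hm. apply henkin_stage_mono. lia.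
  - apply Hn in Hq. revert Hq. apply henkin_stage_mono. lia.
Qed.

Lemma henkin_consistent L :
  (forall p, In p L -> henkin p) -> ~ prv T L Bot.
Proof.
  intros H F. destruct (henkin_finite L H) as [n Hn].
  apply (henkin_stage_consistent n). now apply weaken with L.
Qed.

Lemma henkin_complete p : henkin p \/ henkin (Neg p).
Proof.
  pose (n := form_code p).
  assert (E : form_enum n = p) by apply form_enum_onto.
  destruct (excluded_middle_informative (consistent (p :: henkin_stage n)))
    as [H|H]; [left|right]; exists (S n); cbn [henkin_stage]; rewrite E;
    unfold henkin_step;
    destruct excluded_middle_informative; try easy; [now left|].
  destruct p; cbn; auto.
Qed.

Lemma henkin_closed L p :
  (forall q, In q L -> henkin q) -> prv T L p -> henkin p.
Proof.
  intros H F. destruct (henkin_complete p) as [?|Hn]; [assumption|].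
  exfalso. apply (henkin_consistent (Neg p :: L)).
  - intros q [<-|Hq]; auto.
  - eapply ImpE; [apply Hyp; now left|]. apply weaken with L; [exact F|].
    intros q Hq. now right.
Qed.

Lemma henkin_witness q :
  ~ henkin (All q) -> exists c, ~ henkin (inst c q).
Proof.
  intros Hq. pose (p := All q). pose (n := form_code p).
  assert (E : form_enum n = p) by apply form_enum_onto.
  exists (fresh (Neg p :: henkin_stage n) q). intros Hi.
  apply (henkin_consistent
    [Neg (inst (fresh (Neg p :: henkin_stage n) q) q);
     inst (fresh (Neg p :: henkin_stage n) q) q]).
  - intros r [<-|[<-|[]]]; [|exact Hi].
    exists (S n). cbn [henkin_stage]. rewrite E. unfold henkin_step.
    destruct excluded_middle_informative as [H|H]; [|now left].
    exfalso. apply Hq. exists (S n). cbn [henkin_stage]. rewrite E.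
    unfold henkin_step. destruct excluded_middle_informative; [|easy].
    now left.
  - eapply ImpE; apply Hyp; [now left|right; now left].
Qed.

Lemma henkin_eq_refl t : henkin (Eq t t).
Proof. apply henkin_closed with []; [easy|apply EqRefl]. Qed.

Lemma henkin_eq_subst p s t :
  henkin (Eq s t) -> henkin (inst s p) -> henkin (inst t p).
Proof.
  intros H1 H2. apply henkin_closed with [Eq s t; inst s p].
  - now intros q [<-|[<-|[]]].
  - apply EqSubst with s; apply Hyp; cbn; auto.
Qed.

Lemma henkin_eq_sym s t : henkin (Eq s t) -> henkin (Eq t s).
Proof.
  (* Instantiated at [x], the formula [Eq 0 (S s)] reads [x = s]. *)
  intros H. apply (henkin_eq_subst (Eq 0 (S s)) s t H). apply henkin_eq_refl.
Qed.

Lemma henkin_eq_trans s t u :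
  henkin (Eq s t) -> henkin (Eq t u) -> henkin (Eq s u).
Proof. intros H1 H2. exact (henkin_eq_subst (Eq (S s) 0) t u H2 H1). Qed.

(** * The term model *)

Definition rep (x : nat) : nat :=
  epsilon (inhabits 0) (fun y => henkin (Eq x y)).

Lemma rep_eq x : henkin (Eq x (rep x)).
Proof.
  unfold rep. apply (epsilon_spec (inhabits 0) (fun y => henkin (Eq x y))).
  exists x. apply henkin_eq_refl.
Qed.

(** Provably equal variables give the same predicate to [epsilon], by extensionality, so the same
    representative is chosen. *)
Lemma rep_unique x y : henkin (Eq x y) -> rep x = rep y.
Proof.
  intros H. unfold rep. f_equal. apply functional_extensionality. intros z.
  apply propositional_extensionality. split; intros H'.
  - eapply henkin_eq_trans; [apply henkin_eq_sym|]; eassumption.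
  - eapply henkin_eq_trans; eassumption.
Qed.

(** The quotient by provable equality, realized as the fixed points of [rep], so that [Eq] is
    interpreted by equality of Rocq. *)
Definition term_model : Type := {x : nat | rep x = x}.

Definition term_class (x : nat) : term_model :=
  exist _ (rep x) (eq_sym (rep_unique x (rep x) (rep_eq x))).

Definition term_mem (a b : term_model) : Prop :=
  henkin (Mem (proj1_sig a) (proj1_sig b)).

Lemma truth p : forall e : nat -> term_model,
  sat term_mem e p <-> henkin (ren (fun n => proj1_sig (e n)) p).
Proof.
  induction p as [|i j|i j|p IHp q IHq|q IH]; intros e; cbn.
  - split; [easy|]. intros H. apply (henkin_consistent [Bot]).
    + now intros p [<-|[]].
    + apply Hyp. now left.
  - split; intros H.
    + rewrite H. apply henkin_eq_refl.
    + apply rep_unique in H. rewrite !(proj2_sig (e _)) in H.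
      apply eq_sig_hprop; [intros; apply proof_irrelevance|exact H].
  - reflexivity.
  - rewrite IHp, IHq. split; intros H.
    + destruct (henkin_complete (ren (fun n => proj1_sig (e n)) p))
        as [Hp|Hp].
      * eapply henkin_closed with [_]; [now intros r [<-|[]]; apply H, Hp|].
        apply ImpI, Hyp. right. now left.
      * eapply henkin_closed with [_]; [now intros r [<-|[]]; apply Hp|].
        apply ImpI, Contra. eapply ImpE; apply Hyp.
        -- right. right. now left.
        -- right. now left.
    + intros Hp. apply henkin_closed with
        [Imp (ren (fun n => proj1_sig (e n)) p)
             (ren (fun n => proj1_sig (e n)) q);
         ren (fun n => proj1_sig (e n)) p].
      * now intros r [<-|[<-|[]]].
      * eapply ImpE; apply Hyp; cbn; auto.
  - set (q' := ren (scons 0 (fun n => S (proj1_sig (e n)))) q).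
    assert (E : forall a : term_model,
      ren (fun n => proj1_sig (scons a e n)) q = inst (proj1_sig a) q').
    { intros a. unfold q', inst. rewrite ren_ren. apply ren_ext.
      now intros [|n]. }
    split; intros H.
    + apply NNPP. intros Hq. destruct (henkin_witness q' Hq) as [c Hc].
      apply Hc. specialize (H (term_class c)). rewrite IH, E in H.
      revert H. apply henkin_eq_subst. apply henkin_eq_sym, rep_eq.
    + intros a. rewrite IH, E. apply henkin_closed with [All q'].
      * now intros r [<-|[]].
      * apply AllE, Hyp. now left.
Qed.

End Henkin.

(** If [p] is not provable, [Neg p] is consistent and holds in its term model. Since [p] is closed,
    reading it along the environment does not alter it. *)
Theorem completeness (T : form -> Prop) (p : form) :
  fv_bound p = 0 ->
  (forall (M : Type) (mem : M -> M -> Prop),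
     (forall q e, T q -> sat mem e q) -> forall e, sat mem e p) ->
  proves T p.
Proof.
  intros Hp H. apply prv_ren_closure. apply NNPP. intros F.
  pose (T' := ren_closure T).
  assert (Tren : forall q r, T' q -> T' (ren r q)).
  { intros q r (q0 & r0 & Hq & ->). exists q0, (fun n => r (r0 n)).
    now rewrite ren_ren. }
  assert (HG : consistent T' [Neg p]) by (intros H'; now apply F, Contra).
  pose (e := fun n : nat => term_class T' Tren [Neg p] HG n).
  assert (Hs : sat (term_mem T' [Neg p]) e p).
  { apply H. intros q e' Hq. apply (truth T' Tren [Neg p] HG).
    apply henkin_closed with (L := []); auto; [easy|].
    apply Ax. now exists q, (fun n => proj1_sig (e' n)). }
  apply (truth T' Tren [Neg p] HG) in Hs.
  rewrite (ren_ext_bound _ (fun n => n)), ren_id in Hs by lia.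
  apply (henkin_consistent T' Tren [Neg p] HG [Neg p; p]).
  - intros q [<-|[<-|[]]]; [|exact Hs]. exists 0. now left.
  - eapply ImpE; apply Hyp; [now left|right; now left].
Qed.

(** * Stratified comprehension in a model *)

Lemma sat_ext {M : Type} (mem : M -> M -> Prop) (e e' : nat -> M) (p : form) :
  (forall n, e n = e' n) -> sat mem e p <-> sat mem e' p.
Proof.
  intros E. now replace e' with e by now apply functional_extensionality.
Qed.

Lemma sat_ren {M : Type} (mem : M -> M -> Prop) (r : nat -> nat) (p : form) :
  forall e : nat -> M,
  sat mem e (ren r p) <-> sat mem (fun n => e (r n)) p.
Proof.
  revert r; induction p as [| | |p IHp q IHq|p IH]; intros r e; cbn;
    try reflexivity.
  - now rewrite IHp, IHq.
  - split; intros H a; specialize (H a); revert H; rewrite IH; apply sat_ext;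
      now intros [|n].
Qed.

Lemma stratified_by_ren (r s s' : nat -> nat) (p : form) :
  (forall n, s' (r n) = s n) -> stratified_by s p -> stratified_by s' (ren r p).
Proof.
  revert r s s'; induction p as [| | |p IHp q IHq|p IH]; intros r s s' E; cbn.
  - easy.
  - now rewrite !E.
  - now rewrite !E.
  - intros [Hp Hq]. split; eauto.
  - intros [k Hk]. exists k. eapply IH; [|exact Hk].
    intros [|n]; cbn; auto.
Qed.

Section Model.
Context {M : Type} (mem : M -> M -> Prop).
Local Notation "x ∊ y" := (mem x y) (at level 70).

Definition value (h : nat -> nat + M) (e : nat -> M) (i : nat) : M :=
  match h i with inl n => e n | inr a => a end.

(** [P] is expressed by a formula whose variables are either entries of the
    environment, indexed by [s], or parameters. Distinct occurrences of a
    parameter may be distinct variables of the formula, so that parameters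
    carry no indices at all. *)
Definition def (s : nat -> nat) (P : (nat -> M) -> Prop) : Prop :=
  exists (p : form) (s' : nat -> nat) (h : nat -> nat + M),
    stratified_by s' p /\
    (forall i n, h i = inl n -> s' i = s n) /\
    (forall e, sat mem (value h e) p <-> P e).

Lemma def_iff s P Q : (forall e, P e <-> Q e) -> def s P -> def s Q.
Proof.
  intros E (p & s' & h & H1 & H2 & H3). exists p, s', h.
  repeat split; auto; intros H; [apply E, H3, H|apply H3, E, H].
Qed.

(** A proposition independent of the environment is replaced by its truth value, so it is never
    asked to be stratified. *)
Lemma def_const s (Q : Prop) : def s (fun _ => Q).
Proof.
  destruct (classic Q) as [H|H].
  - exists (Imp Bot Bot), s, inl. split; [easy|split].
    + now intros i n [= ->].
    + intros e. cbn. tauto.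
  - exists Bot, s, inl. split; [easy|split].
    + now intros i n [= ->].
    + intros e. cbn. tauto.
Qed.

(** Interleaving, to give two formulas disjoint sets of variables. *)
Definition merge {A : Type} (f g : nat -> A) (n : nat) : A :=
  if Nat.even n then f (Nat.div2 n) else g (Nat.div2 n).

Lemma merge_even {A : Type} (f g : nat -> A) n : merge f g (2 * n) = f n.
Proof.
  unfold merge. rewrite Nat.even_mul, Nat.div2_double. reflexivity.
Qed.

Lemma merge_odd {A : Type} (f g : nat -> A) n : merge f g (S (2 * n)) = g n.
Proof.
  unfold merge. rewrite Nat.div2_succ_double, Nat.even_succ, Nat.odd_mul.
  reflexivity.
Qed.

Lemma merge_ind {A : Type} (f g : nat -> A) (Q : A -> nat -> Prop) :
  (forall n, Q (f n) (2 * n)) -> (forall n, Q (g n) (S (2 * n))) ->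
  forall n, Q (merge f g n) n.
Proof.
  intros Hf Hg n. destruct (Nat.Even_or_Odd n) as [[m ->]|[m ->]].
  - now rewrite merge_even.
  - rewrite Nat.add_1_r. now rewrite merge_odd.
Qed.

(** Once the variables are separated, the two index assignments cannot clash: both agree with [s] on
    entries of the environment, and a common parameter becomes two variables. *)
Lemma def_imp s P Q : def s P -> def s Q -> def s (fun e => P e -> Q e).
Proof.
  intros (p & s1 & h1 & Hp & E1 & Vp) (q & s2 & h2 & Hq & E2 & Vq).
  exists (Imp (ren (fun n => 2 * n) p) (ren (fun n => S (2 * n)) q)),
    (merge s1 s2), (merge h1 h2).
  split; [split|split].
  - eapply stratified_by_ren; [|exact Hp]. intros n. apply merge_even.
  - eapply stratified_by_ren; [|exact Hq]. intros n. apply merge_odd.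
  - apply (merge_ind h1 h2 (fun v i => forall n, v = inl n ->
                                      merge s1 s2 i = s n)).
    + intros i. rewrite merge_even. auto.
    + intros i. rewrite merge_odd. auto.
  - intros e. cbn [sat]. rewrite !sat_ren.
    assert (A : sat mem (fun n => value (merge h1 h2) e (2 * n)) p <-> P e).
    { rewrite <- Vp. apply sat_ext. intros n. unfold value.
      now rewrite merge_even. }
    assert (B : sat mem (fun n => value (merge h1 h2) e (S (2 * n))) q <-> Q e).
    { rewrite <- Vq. apply sat_ext. intros n. unfold value.
      now rewrite merge_odd. }
    now rewrite A, B.
Qed.

(** The variables standing for entry 0 of the environment are identified to a
    single one, which can then be bound. *)
Lemma def_bind s k P (a0 : M) :
  def (scons k s) P ->
  exists p s' h,
    stratified_by (scons k s') p /\
    (forall i n, h i = inl n -> s' i = s n) /\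
    (forall a e, sat mem (scons a (value h e)) p <-> P (scons a e)).
Proof.
  intros (p & s1 & h1 & Hp & E1 & Vp).
  exists (ren (fun i => match h1 i with inl 0 => 0 | _ => S i end) p),
    s1,
    (fun i => match h1 i with inl (S n) => inl n | inl 0 => inr a0
                         | inr a => inr a end).
  split; [|split].
  - eapply stratified_by_ren; [|exact Hp]. intros i.
    destruct (h1 i) as [[|n]|a] eqn:E; cbn; auto. symmetry.
    now apply (E1 i 0).
  - intros i n H. destruct (h1 i) as [[|n']|a] eqn:E; try discriminate.
    injection H as ->. now apply (E1 i (S n)).
  - intros a e. rewrite sat_ren, <- Vp. apply sat_ext. intros i.
    unfold value. destruct (h1 i) as [[|n]|b] eqn:E; cbn; rewrite ?E;
      reflexivity.
Qed.

Lemma def_all s k (P : (nat -> M) -> M -> Prop) :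
  def (scons k s) (fun e => P (fun n => e (S n)) (e 0)) ->
  def s (fun e => forall a, P e a).
Proof.
  (* [def_bind] needs a default element; over an empty domain the quantifier is vacuous. *)
  intros H. destruct (classic (inhabited M)) as [[a0]|N].
  - destruct (def_bind s k _ a0 H) as (p & s' & h & H1 & H2 & H3).
    exists (All p), s', h. split; [now exists k|split; [exact H2|]].
    intros e. split; intros F a; apply (H3 a e), F.
  - apply def_iff with (fun _ => True); [|apply def_const].
    intros e. split; auto. intros _ a. now destruct N.
Qed.

Lemma def_not s P : def s P -> def s (fun e => ~ P e).
Proof. intros H. apply def_imp; [exact H|apply def_const]. Qed.

Lemma def_and s P Q : def s P -> def s Q -> def s (fun e => P e /\ Q e).
Proof.
  intros HP HQ. apply def_iff with (fun e => ~ (P e -> ~ Q e)).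
  - intros e. tauto.
  - now apply def_not, def_imp, def_not.
Qed.

Lemma def_or s P Q : def s P -> def s Q -> def s (fun e => P e \/ Q e).
Proof.
  intros HP HQ. apply def_iff with (fun e => ~ P e -> Q e).
  - intros e. tauto.
  - now apply def_imp; [apply def_not|].
Qed.

Lemma def_equiv s P Q : def s P -> def s Q -> def s (fun e => P e <-> Q e).
Proof. intros HP HQ. apply def_and; now apply def_imp. Qed.

Lemma def_ex s k (P : (nat -> M) -> M -> Prop) :
  def (scons k s) (fun e => P (fun n => e (S n)) (e 0)) ->
  def s (fun e => exists a, P e a).
Proof.
  intros H. apply def_iff with (fun e => ~ forall a, ~ P e a).
  - intros e. split; [apply not_all_not_ex|]. intros [a Ha] F. now apply (F a).
  - apply def_not, (def_all s k (fun e a => ~ P e a)), def_not, H.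
Qed.

Lemma def_weaken s s' (r : nat -> nat) P :
  (forall n, s' (r n) = s n) -> def s P ->
  def s' (fun e => P (fun n => e (r n))).
Proof.
  intros E (p & s1 & h & H1 & H2 & H3).
  exists p, s1,
    (fun i => match h i with inl n => inl (r n) | inr a => inr a end).
  split; [exact H1|split].
  - intros i n. destruct (h i) as [m|a] eqn:Ei; [|easy]. intros [= <-].
    rewrite E. auto.
  - intros e. rewrite <- H3. apply sat_ext. intros i. unfold value.
    now destruct (h i).
Qed.

(** The language has no terms, so a set term of index [k] is represented by its graph, with the
    value at index [k]. *)
Definition dterm (s : nat -> nat) (k : nat) (t : (nat -> M) -> M) : Prop :=
  def (scons k s) (fun e => e 0 = t (fun n => e (S n))).

Lemma def_eq_var s i j : s i = s j -> def s (fun e => e i = e j).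
Proof.
  intros E. exists (Eq i j), s, inl. split; [exact E|split].
  - now intros n m [= ->].
  - now intros e.
Qed.

Lemma def_mem_var s i j : s j = S (s i) -> def s (fun e => e i ∊ e j).
Proof.
  intros E. exists (Mem i j), s, inl. split; [exact E|split].
  - now intros n m [= ->].
  - now intros e.
Qed.

Lemma dterm_var s k i : s i = k -> dterm s k (fun e => e i).
Proof. intros E. apply (def_eq_var _ 0 (S i)). now symmetry. Qed.

(** Parameters carry no index of their own, so any [k] will do. *)
Lemma dterm_const s k (c : M) : dterm s k (fun _ => c).
Proof.
  exists (Eq 0 1), (fun _ => k),
    (fun i => match i with 0 => inl 0 | _ => inr c end).
  split; [reflexivity|split].
  - intros [|i] n; [now intros [= <-]|easy].
  - now intros e.
Qed.

Lemma dterm_weaken s s' (r : nat -> nat) k t :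
  (forall n, s' (r n) = s n) -> dterm s k t ->
  dterm s' k (fun e => t (fun n => e (r n))).
Proof.
  intros E H. unfold dterm in *.
  apply (def_weaken _ (scons k s')
           (fun n => match n with 0 => 0 | S n => S (r n) end)) in H;
    [exact H|].
  intros [|n]; cbn; auto.
Qed.

Lemma def_subst s k (P : (nat -> M) -> M -> Prop) t :
  dterm s k t -> def (scons k s) (fun e => P (fun n => e (S n)) (e 0)) ->
  def s (fun e => P e (t e)).
Proof.
  intros Ht HP. apply def_iff with (fun e => exists a, a = t e /\ P e a).
  - intros e. split; [now intros (a & -> & H)|eauto].
  - apply (def_ex s k (fun e a => a = t e /\ P e a)), def_and; assumption.
Qed.

Lemma def_subst2 s k l (P : M -> M -> Prop) t u :
  dterm s k t -> dterm s l u ->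
  def (scons k (scons l s)) (fun e => P (e 0) (e 1)) ->
  def s (fun e => P (t e) (u e)).
Proof.
  intros Ht Hu H. apply (def_subst s l (fun e b => P (t e) b)); [exact Hu|].
  apply (def_subst _ k (fun e a => P a (e 0))); [|exact H].
  now apply (dterm_weaken s _ S).
Qed.

Lemma dterm_subst s k l (F : M -> M) t :
  dterm s k t -> dterm (scons k s) l (fun e => F (e 0)) ->
  dterm s l (fun e => F (t e)).
Proof.
  intros Ht HF. apply (def_subst _ k (fun e a => e 0 = F a)).
  - now apply (dterm_weaken s _ S).
  (* The graph of [F] has its value before its argument; under the quantifier over the argument the
     two come in the other order. *)
  - apply (def_weaken _ (scons k (scons l s))
             (fun n => match n with 0 => 1 | 1 => 0 | S (S n) => S (S n) end))
      in HF; [exact HF|]. now intros [|[|n]].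
Qed.

Lemma dterm_subst2 s k l m (F : M -> M -> M) t u :
  dterm s k t -> dterm s l u ->
  dterm (scons k (scons l s)) m (fun e => F (e 0) (e 1)) ->
  dterm s m (fun e => F (t e) (u e)).
Proof.
  intros Ht Hu HF.
  apply (def_subst _ l (fun e b => e 0 = F (t (fun n => e (S n))) b)).
  - now apply (dterm_weaken s _ S).
  - apply (def_subst _ k (fun e a => e 1 = F a (e 0))).
    + now apply (dterm_weaken s _ (fun n => S (S n))).
    + apply (def_weaken _ (scons k (scons l (scons m s)))
               (fun n => match n with 0 => 2 | 1 => 0 | 2 => 1
                         | S (S (S n)) => S (S (S n)) end)) in HF;
        [exact HF|]. now intros [|[|[|n]]].
Qed.

Lemma def_eq s k t u :
  dterm s k t -> dterm s k u -> def s (fun e => t e = u e).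
Proof.
  intros Ht Hu. apply (def_subst2 s k k eq); auto.
  now apply (def_eq_var _ 0 1).
Qed.

Lemma def_mem s k t u :
  dterm s k t -> dterm s (S k) u -> def s (fun e => t e ∊ u e).
Proof.
  intros Ht Hu. apply (def_subst2 s k (S k) mem); auto.
  now apply (def_mem_var _ 0 1).
Qed.

(** * Sets given by stratified predicates *)

Context (ext : forall x y, (forall z, z ∊ x <-> z ∊ y) -> x = y)
        (comp : forall p s e, stratified_by s p ->
                exists X, forall x, x ∊ X <-> sat mem (scons x e) p)
        (a0 : M).

(** Arbitrary unless [isset P]. *)
Definition setof (P : M -> Prop) : M :=
  epsilon (inhabits a0) (fun X => forall x, x ∊ X <-> P x).

Definition isset (P : M -> Prop) : Prop := exists X, forall x, x ∊ X <-> P x.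

Lemma in_setof P x : isset P -> (x ∊ setof P <-> P x).
Proof. intros H. revert x. unfold setof. apply epsilon_spec. exact H. Qed.

Lemma setof_unique P X : (forall x, x ∊ X <-> P x) -> X = setof P.
Proof.
  intros H. apply ext. intros z. rewrite H. symmetry. apply in_setof.
  now exists X.
Qed.

Lemma isset_def_env s k (P : (nat -> M) -> M -> Prop) e :
  def (scons k s) (fun e => P (fun n => e (S n)) (e 0)) -> isset (P e).
Proof.
  intros H. destruct (def_bind s k _ a0 H) as (p & s' & h & H1 & H2 & H3).
  destruct (comp p _ (value h e) H1) as [X HX]. exists X. intros x.
  rewrite HX. apply (H3 x e).
Qed.

Lemma isset_def k (P : M -> Prop) :
  def (scons k (fun _ => 0)) (fun e => P (e 0)) -> isset P.
Proof.
  intros H. now apply (isset_def_env (fun _ => 0) k (fun _ => P) (fun _ => a0)).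
Qed.

(** By extensionality, being equal to the set means having the same elements, which is a stratified
    condition with the set one index above its elements. *)
Lemma dterm_setof s k (P : (nat -> M) -> M -> Prop) :
  def (scons k s) (fun e => P (fun n => e (S n)) (e 0)) ->
  dterm s (S k) (fun e => setof (P e)).
Proof.
  intros H. unfold dterm.
  apply def_iff with
    (fun e => forall x, x ∊ e 0 <-> P (fun n => e (S n)) x).
  - intros e. split; [apply setof_unique|]. intros -> x. apply in_setof.
    now apply (isset_def_env s k).
  - apply (def_all _ k (fun e x => x ∊ e 0 <-> P (fun n => e (S n)) x)).
    apply def_equiv; [now apply (def_mem_var _ 0 1)|].
    apply (def_weaken _ (scons k (scons (S k) s))
             (fun n => match n with 0 => 0 | S n => S (S n) end)) in H;
      [exact H|]. now intros [|n].
Qed.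

(** A hook, redefined whenever closure lemmas for further notions become available. *)
Ltac strat_named := fail.

Ltac strat_step :=
  lazymatch goal with
  | |- def _ (fun _ => ?Q) => apply def_const
  | |- def ?s (fun e => forall x : M, @?P e x) => eapply (def_all s _ P)
  | |- def ?s (fun e => @?P e /\ @?Q e) => apply (def_and s P Q)
  | |- def ?s (fun e => @?P e \/ @?Q e) => apply (def_or s P Q)
  | |- def ?s (fun e => ~ @?P e) => apply (def_not s P)
  | |- def ?s (fun e => @?P e <-> @?Q e) => apply (def_equiv s P Q)
  | |- def ?s (fun e => @?P e -> @?Q e) => apply (def_imp s P Q)
  | |- def ?s (fun e => exists x : M, @?P e x) => eapply (def_ex s _ P)
  | |- def ?s (fun e => mem (@?t e) (@?u e)) => eapply (def_mem s _ t u)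
  | |- def ?s (fun e => @?t e = @?u e) => eapply (def_eq s _ t u)
  | |- dterm _ _ (fun _ => ?c) => apply dterm_const
  | |- dterm _ _ (fun e => e ?i) => apply dterm_var; cbn [scons]; reflexivity
  | |- dterm ?s _ (fun e => setof (@?P e)) => eapply (dterm_setof s _ P)
  | |- _ => strat_named
  end; cbv beta.

(** The indices are existential variables solved by unification; those left undetermined are
    arbitrary and set to 0. *)
Ltac strat := unshelve (repeat strat_step); try exact 0.
Ltac set_exists := unshelve (eapply isset_def; repeat strat_step); exact 0.

(** * Elementary sets and Kuratowski pairs *)

Definition empty : M := setof (fun _ => False).
Definition univ : M := setof (fun _ => True).
Definition sing (x : M) : M := setof (fun t => t = x).
Definition upair (x y : M) : M := setof (fun t => t = x \/ t = y).
Definition pair (x y : M) : M := setof (fun a => a = sing x \/ a = upair x y).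

Lemma in_empty x : ~ x ∊ empty.
Proof. unfold empty. rewrite in_setof by set_exists. easy. Qed.

Lemma in_univ x : x ∊ univ.
Proof. unfold univ. rewrite in_setof by set_exists. easy. Qed.

Lemma in_sing x y : y ∊ sing x <-> y = x.
Proof. unfold sing. now rewrite in_setof by set_exists. Qed.

Lemma in_upair x y z : z ∊ upair x y <-> z = x \/ z = y.
Proof. unfold upair. now rewrite in_setof by set_exists. Qed.

Lemma in_pair x y z : z ∊ pair x y <-> z = sing x \/ z = upair x y.
Proof. unfold pair. now rewrite in_setof by set_exists. Qed.

Lemma dterm_sing s k t : dterm s k t -> dterm s (S k) (fun e => sing (t e)).
Proof.
  intros H. apply (dterm_subst s k _ sing); [exact H|]. unfold sing. strat.
Qed.

Lemma dterm_upair s k t u :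
  dterm s k t -> dterm s k u -> dterm s (S k) (fun e => upair (t e) (u e)).
Proof.
  intros Ht Hu. apply (dterm_subst2 s k k _ upair); auto. unfold upair. strat.
Qed.

Lemma dterm_pair s k t u :
  dterm s k t -> dterm s k u -> dterm s (S (S k)) (fun e => pair (t e) (u e)).
Proof.
  intros Ht Hu. apply (dterm_subst2 s k k _ pair); auto.
  unfold pair, sing, upair. strat.
Qed.

Ltac strat_pairs :=
  first [ simple eapply dterm_sing | simple eapply dterm_upair
        | simple eapply dterm_pair ].
Ltac strat_named ::= strat_pairs.

Lemma sing_inj x y : sing x = sing y -> x = y.
Proof. intros E. apply in_sing. rewrite <- E. now apply in_sing. Qed.

Lemma sing_upair x y z : sing x = upair y z -> x = y /\ x = z.
Proof.
  intros E. split; symmetry; apply in_sing; rewrite E; apply in_upair; auto.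
Qed.

Lemma pair_inj x y x' y' : pair x y = pair x' y' -> x = x' /\ y = y'.
Proof.
  intros E.
  assert (Hx : x = x').
  { assert (H : sing x ∊ pair x' y') by (rewrite <- E; apply in_pair; auto).
    apply in_pair in H as [H|H]; [now apply sing_inj|].
    now apply sing_upair in H. }
  subst x'. split; [reflexivity|].
  assert (A : forall u v, pair x u = pair x v -> u = x \/ u = v).
  { intros u v F.
    assert (H : upair x u ∊ pair x v) by (rewrite <- F; apply in_pair; auto).
    assert (Hu : u ∊ upair x u) by (apply in_upair; auto).
    apply in_pair in H as [H|H]; rewrite H in Hu.
    - left. now apply in_sing.
    - now apply in_upair. }
  destruct (A y y' E) as [->|]; [|assumption].
  destruct (A y' x (eq_sym E)); congruence.
Qed.

(** The two arguments of [R] need the same index, because the components of a Kuratowski pair do. *)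
Lemma graph_exists k (R : M -> M -> Prop) :
  def (scons k (scons k (fun _ => 0))) (fun e => R (e 1) (e 0)) ->
  exists r, forall x y, pair x y ∊ r <-> R x y.
Proof.
  intros H. exists (setof (fun p => exists x y, p = pair x y /\ R x y)).
  intros x y. rewrite in_setof.
  - split; [|eauto]. intros (x' & y' & E & HR).
    now apply pair_inj in E as [-> ->].
  - apply (isset_def (S (S k))).
    apply (def_ex _ k (fun e x => exists y, e 0 = pair x y /\ R x y)).
    apply (def_ex _ k (fun e y => e 1 = pair (e 0) y /\ R (e 0) y)).
    apply def_and; [strat|].
    apply (def_weaken _ (scons k (scons k (scons (S (S k)) (fun _ => 0))))
             (fun n => match n with 0 => 0 | 1 => 1
                       | S (S n) => S (S (S n)) end))
      in H; [exact H|].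
    now intros [|[|n]].
Qed.

Definition func (f : M) : Prop :=
  forall x y z, pair x y ∊ f -> pair x z ∊ f -> y = z.

Definition incl_set (A B : M) : Prop := forall t, t ∊ A -> t ∊ B.
Definition adjoin (A a : M) : M := setof (fun x => x ∊ A \/ x = a).
Definition remove (A a : M) : M := setof (fun x => x ∊ A /\ x <> a).
Definition usc (A : M) : M := setof (fun u => exists x, x ∊ A /\ u = sing x).
Definition pow (A : M) : M := setof (fun u => incl_set u A).

Lemma in_adjoin A a x : x ∊ adjoin A a <-> x ∊ A \/ x = a.
Proof. unfold adjoin. now rewrite in_setof by set_exists. Qed.

Lemma in_remove A a x : x ∊ remove A a <-> x ∊ A /\ x <> a.
Proof. unfold remove. now rewrite in_setof by set_exists. Qed.

Lemma in_usc A x : x ∊ usc A <-> exists y, y ∊ A /\ x = sing y.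
Proof. unfold usc. now rewrite in_setof by set_exists. Qed.

Lemma sing_in_usc A x : sing x ∊ usc A <-> x ∊ A.
Proof.
  rewrite in_usc. split; [|eauto]. now intros (y & Hy & ->%sing_inj).
Qed.

Lemma in_pow A x : x ∊ pow A <-> incl_set x A.
Proof. unfold pow, incl_set. now rewrite in_setof by set_exists. Qed.

Lemma incl_antisym A B : incl_set A B -> incl_set B A -> A = B.
Proof. intros H1 H2. apply ext. intros z. split; auto. Qed.

Lemma def_func s k t : dterm s (S (S (S k))) t -> def s (fun e => func (t e)).
Proof.
  intros H. apply (def_subst s _ (fun _ => func) t H). unfold func. strat.
Qed.

Lemma def_incl s k t u :
  dterm s (S k) t -> dterm s (S k) u -> def s (fun e => incl_set (t e) (u e)).
Proof.
  intros Ht Hu. apply (def_subst2 s _ _ incl_set t u Ht Hu).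
  unfold incl_set. strat.
Qed.

Lemma dterm_adjoin s k t u :
  dterm s (S k) t -> dterm s k u -> dterm s (S k) (fun e => adjoin (t e) (u e)).
Proof.
  intros Ht Hu. apply (dterm_subst2 s _ _ _ adjoin t u Ht Hu).
  unfold adjoin. strat.
Qed.

Lemma dterm_usc s k t :
  dterm s (S k) t -> dterm s (S (S k)) (fun e => usc (t e)).
Proof.
  intros H. apply (dterm_subst s _ _ usc t H). unfold usc. strat.
Qed.

Lemma dterm_pow s k t :
  dterm s (S k) t -> dterm s (S (S k)) (fun e => pow (t e)).
Proof.
  intros H. apply (dterm_subst s _ _ pow t H). unfold pow, incl_set. strat.
Qed.
Ltac strat_sets :=
  first [ strat_pairs | simple eapply def_func | simple eapply def_incl
        | simple eapply dterm_adjoin | simple eapply dterm_usc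
        | simple eapply dterm_pow ].
Ltac strat_named ::= strat_sets.

(** * Equinumerosity *)

Definition sim (A B : M) : Prop :=
  exists r,
    (forall x, x ∊ A -> exists y, y ∊ B /\ pair x y ∊ r) /\
    (forall y, y ∊ B -> exists x, x ∊ A /\ pair x y ∊ r) /\
    (forall x x' y y', x ∊ A -> x' ∊ A -> y ∊ B -> y' ∊ B ->
       pair x y ∊ r -> pair x' y' ∊ r -> (x = x' <-> y = y')).

Lemma def_sim s k t u :
  dterm s (S k) t -> dterm s (S k) u -> def s (fun e => sim (t e) (u e)).
Proof.
  intros Ht Hu. apply (def_subst2 s _ _ sim t u Ht Hu). unfold sim. strat.
Qed.

(** Allows a bijection to be given as a stratified relation of Rocq instead of a set of pairs. *)
Lemma sim_intro k (R : M -> M -> Prop) A B :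
  def (scons k (scons k (fun _ => 0))) (fun e => R (e 1) (e 0)) ->
  (forall x, x ∊ A -> exists y, y ∊ B /\ R x y) ->
  (forall y, y ∊ B -> exists x, x ∊ A /\ R x y) ->
  (forall x x' y y', x ∊ A -> x' ∊ A -> y ∊ B -> y' ∊ B ->
     R x y -> R x' y' -> (x = x' <-> y = y')) ->
  sim A B.
Proof.
  intros HR H1 H2 H3. destruct (graph_exists k R HR) as [r Hr].
  exists r. split; [|split].
  - intros x Hx. destruct (H1 x Hx) as (y & Hy & ?). exists y. now rewrite Hr.
  - intros y Hy. destruct (H2 y Hy) as (x & Hx & ?). exists x. now rewrite Hr.
  - intros x x' y y'. rewrite !Hr. apply H3.
Qed.

Ltac sim_by R :=
  unshelve (eapply (sim_intro _ R); [solve [repeat strat_step]|..]);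
  [exact 0|..].

Lemma sim_refl A : sim A A.
Proof.
  sim_by (fun x y : M => x = y); eauto. intros; subst. tauto.
Qed.

Lemma sim_sym A B : sim A B -> sim B A.
Proof.
  intros (r & H1 & H2 & H3). sim_by (fun x y => pair y x ∊ r); auto.
  intros x x' y y' ? ? ? ? Hr Hr'. symmetry. now apply H3.
Qed.

Lemma sim_trans A B C : sim A B -> sim B C -> sim A C.
Proof.
  intros (r & H1 & H2 & H3) (q & K1 & K2 & K3).
  sim_by (fun x z => exists y, y ∊ B /\ pair x y ∊ r /\ pair y z ∊ q).
  - intros x Hx. destruct (H1 x Hx) as (y & Hy & ?).
    destruct (K1 y Hy) as (z & Hz & ?). eauto 6.
  - intros z Hz. destruct (K2 z Hz) as (y & Hy & ?).
    destruct (H2 y Hy) as (x & Hx & ?). eauto 6.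
  - intros x x' z z' Hx Hx' Hz Hz' (y & Hy & ? & ?) (y' & Hy' & ? & ?).
    rewrite (H3 x x' y y'), (K3 y y' z z'); auto. reflexivity.
Qed.

Lemma sim_subset A B A' :
  sim A B -> incl_set A' A -> exists B', incl_set B' B /\ sim A' B'.
Proof.
  intros (r & H1 & H2 & H3) I.
  assert (isset (fun y => y ∊ B /\ exists x, x ∊ A' /\ pair x y ∊ r))
    as [B' HB'] by set_exists.
  exists B'. split; [intros y Hy; now apply HB'|].
  (* The same [r] serves: [sim] disregards pairs outside the two sets. *)
  exists r. split; [|split].
  - intros x Hx. destruct (H1 x) as (y & ? & ?); auto. exists y.
    rewrite HB'. eauto.
  - intros y Hy. apply HB' in Hy as [_ ?]. assumption.
  - intros x x' y y' ? ? Hy Hy'. apply HB' in Hy as [? _].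
    apply HB' in Hy' as [? _]. auto.
Qed.

Lemma sim_adjoin A B a b :
  ~ a ∊ A -> ~ b ∊ B -> sim A B -> sim (adjoin A a) (adjoin B b).
Proof.
  intros Ha Hb (r & H1 & H2 & H3).
  sim_by (fun x y => (x ∊ A /\ y ∊ B /\ pair x y ∊ r) \/ (x = a /\ y = b)).
  - intros x [Hx| ->]%in_adjoin.
    + destruct (H1 x Hx) as (y & ? & ?). exists y. rewrite in_adjoin. auto.
    + exists b. rewrite in_adjoin. auto.
  - intros y [Hy| ->]%in_adjoin.
    + destruct (H2 y Hy) as (x & ? & ?). exists x. rewrite in_adjoin. auto.
    + exists a. rewrite in_adjoin. auto.
  - intros x x' y y' _ _ _ _ [(? & ? & ?)|[-> ->]] [(? & ? & ?)|[-> ->]];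
      [auto|split; intros; subst; contradiction..|tauto].
Qed.

(* If the bijection sends [c] to [b], then [c] is sent instead to the former
   value of [a]. *)
Lemma sim_remove A a W b :
  ~ a ∊ A -> b ∊ W -> sim (adjoin A a) W -> sim A (remove W b).
Proof.
  intros Ha Hb (r & H1 & H2 & H3).
  assert (Haa : a ∊ adjoin A a) by (apply in_adjoin; auto).
  assert (HA : forall x, x ∊ A -> x ∊ adjoin A a)
    by (intros; apply in_adjoin; auto).
  assert (Hna : forall x, x ∊ A -> x <> a) by (intros x Hx ->; auto).
  sim_by (fun x y => pair x y ∊ r \/ (pair x b ∊ r /\ pair a y ∊ r)).
  - intros x Hx. destruct (H1 x) as (y & Hy & Hr); auto.
    destruct (classic (y = b)) as [->|N].
    + destruct (H1 a Haa) as (y & Hy' & Hr'). exists y. rewrite in_remove.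
      repeat split; auto. intros ->.
      apply (Hna x Hx). now apply (H3 x a b b); auto.
    + exists y. rewrite in_remove. auto.
  - intros y [Hy N]%in_remove. destruct (H2 y Hy) as (x & Hx & Hr).
    apply in_adjoin in Hx as Hx'. destruct Hx' as [Hx'| ->]; [now eauto|].
    destruct (H2 b Hb) as (x' & Hx' & Hr'). exists x'.
    apply in_adjoin in Hx' as Hx''. destruct Hx'' as [?| ->]; [now auto|].
    destruct N. now apply (H3 a a y b).
  - intros x x' y y' Hx Hx' [Hy N]%in_remove [Hy' N']%in_remove
      [Hr|[Hr1 Hr2]] [Hr'|[Hr1' Hr2']].
    + now apply H3; auto.
    + split; intros E; subst.
      * destruct N. now apply (H3 x' x' y b); auto.
      * destruct (Hna x Hx). now apply (H3 x a y' y'); auto.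
    + split; intros E; subst.
      * destruct N'. now apply (H3 x' x' y' b); auto.
      * destruct (Hna x' Hx'). now apply (H3 x' a y' y'); auto.
    + split; intros E; subst.
      * now apply (H3 a a y y'); auto.
      * now apply (H3 x x' b b); auto.
Qed.

Lemma sim_usc A B : sim A B -> sim (usc A) (usc B).
Proof.
  intros (r & H1 & H2 & H3).
  sim_by (fun u v => exists x y, u = sing x /\ v = sing y /\ pair x y ∊ r).
  - intros u (x & Hx & ->)%in_usc. destruct (H1 x Hx) as (y & Hy & Hr).
    exists (sing y). rewrite sing_in_usc. eauto 8.
  - intros v (y & Hy & ->)%in_usc. destruct (H2 y Hy) as (x & Hx & Hr).
    exists (sing x). rewrite sing_in_usc. eauto 8.
  - intros u u' v v' Hu Hu' Hv Hv' (x & y & -> & -> & Hr)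
      (x' & y' & -> & -> & Hr').
    rewrite sing_in_usc in *.
    specialize (H3 x x' y y' Hu Hu' Hv Hv' Hr Hr').
    split; intros E%sing_inj; f_equal; tauto.
Qed.

Lemma sim_usc_inj A B : sim (usc A) (usc B) -> sim A B.
Proof.
  intros (r & H1 & H2 & H3).
  sim_by (fun x y => pair (sing x) (sing y) ∊ r).
  - intros x Hx. destruct (H1 (sing x)) as (v & Hv & Hr);
      [now apply sing_in_usc|].
    apply in_usc in Hv as (y & Hy & ->). eauto.
  - intros y Hy. destruct (H2 (sing y)) as (v & Hv & Hr);
      [now apply sing_in_usc|].
    apply in_usc in Hv as (x & Hx & ->). eauto.
  - intros x x' y y' Hx Hx' Hy Hy' Hr Hr'.
    rewrite <- sing_in_usc in Hx, Hx', Hy, Hy'.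
    specialize (H3 _ _ _ _ Hx Hx' Hy Hy' Hr Hr').
    split; intros E; apply sing_inj, H3; now f_equal.
Qed.

Lemma sim_pow A B : sim A B -> sim (pow A) (pow B).
Proof.
  intros (r & H1 & H2 & H3).
  (* Subsets correspond when [r] matches their elements; the partners are images and inverse images
     under [r]. *)
  sim_by (fun u v => (forall x y, x ∊ A -> y ∊ B -> pair x y ∊ r ->
                                  (x ∊ u <-> y ∊ v))).
  - intros u Hu. rewrite in_pow in Hu.
    assert (isset (fun y => y ∊ B /\ exists x, x ∊ u /\ pair x y ∊ r))
      as [v Hv] by set_exists.
    exists v. rewrite in_pow. split; [intros y Hy; now apply Hv|].
    intros x y Hx Hy Hr. rewrite Hv. split; [eauto|].
    intros (_ & x' & Hx' & Hr'). replace x with x'; [assumption|].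
    now apply (H3 x' x y y); auto.
  - intros v Hv. rewrite in_pow in Hv.
    assert (isset (fun x => x ∊ A /\ exists y, y ∊ v /\ pair x y ∊ r))
      as [u Hu] by set_exists.
    exists u. rewrite in_pow. split; [intros y Hy; now apply Hu|].
    intros x y Hx Hy Hr. rewrite Hu. split; [|eauto].
    intros (_ & y' & Hy' & Hr'). replace y with y'; [assumption|].
    now apply (H3 x x y' y); auto.
  - intros u u' v v' Hu Hu' Hv Hv' HR HR'. rewrite in_pow in *.
    split; intros E; subst; apply ext; intros z; split; intros Hz.
    + destruct (H2 z) as (x & Hx & Hr); auto.
      apply (HR' x z); auto. apply (HR x z); auto.
    + destruct (H2 z) as (x & Hx & Hr); auto.
      apply (HR x z); auto. apply (HR' x z); auto.
    + destruct (H1 z) as (y & Hy & Hr); auto.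
      apply (HR' z y); auto. apply (HR z y); auto.
    + destruct (H1 z) as (y & Hy & Hr); auto.
      apply (HR z y); auto. apply (HR' z y); auto.
Qed.

(** The bijection sends {x} to USC(x). Both are one index above x, which makes it stratified, unlike
    the map from x to USC(x). *)
Lemma sim_pow_usc A : sim (usc (pow A)) (pow (usc A)).
Proof.
  sim_by (fun u v => exists x, u = sing x /\ v = usc x).
  - intros u (x & Hx & ->)%in_usc. exists (usc x). split; [|eauto].
    apply in_pow. intros y (z & Hz & ->)%in_usc. apply sing_in_usc.
    rewrite in_pow in Hx. auto.
  - intros v Hv. rewrite in_pow in Hv.
    assert (isset (fun y => sing y ∊ v)) as [x Hx] by set_exists.
    exists (sing x). split.
    + apply sing_in_usc, in_pow. intros y Hy. apply sing_in_usc, Hv, Hx, Hy.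
    + exists x. split; [reflexivity|]. apply ext. intros z.
      rewrite in_usc. split.
      * intros Hz. destruct (proj1 (in_usc _ _) (Hv z Hz)) as (y & _ & ->).
        exists y. rewrite Hx. auto.
      * intros (y & Hy & ->). now apply Hx.
  - intros u u' v v' _ _ _ _ (x & -> & ->) (x' & -> & ->). split; intros E.
    + now apply sing_inj in E as ->.
    + f_equal. apply ext. intros z.
      now rewrite <- (sing_in_usc x), E, sing_in_usc.
Qed.

(** A set of singletons is USC of the set of elements of those singletons. *)
Lemma sim_usc_univ_subset A W :
  sim A W -> incl_set W (usc univ) -> exists Z, sim A (usc Z).
Proof.
  intros H I. exists (setof (fun y => sing y ∊ W)).
  replace (usc _) with W; [exact H|]. apply ext. intros z.
  rewrite in_usc. split.
  - intros Hz. destruct (proj1 (in_usc _ _) (I z Hz)) as (y & _ & ->).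
    exists y. rewrite in_setof by set_exists. auto.
  - intros (y & Hy & ->). rewrite in_setof in Hy by set_exists. exact Hy.
Qed.
(** * The universe is not finite *)

Lemma sim_empty A : sim A empty -> A = empty.
Proof.
  intros (r & H & _). apply ext. intros z. split; intros Hz.
  - destruct (H z Hz) as (y & Hy & _). now apply in_empty in Hy.
  - now apply in_empty in Hz.
Qed.

(** * Comparison of cardinals, finite sets and exponentiation *)

Definition le_card (A B : M) : Prop := exists W, incl_set W B /\ sim A W.

Lemma def_le_card s k t u :
  dterm s (S k) t -> dterm s (S k) u -> def s (fun e => le_card (t e) (u e)).
Proof.
  intros Ht Hu. apply (def_subst2 s _ _ le_card t u Ht Hu).
  unfold le_card, incl_set, sim. strat.
Qed.

Lemma incl_le_card A B : incl_set A B -> le_card A B.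
Proof. intros I. exists A. split; [exact I|apply sim_refl]. Qed.

Lemma sim_le_card A B : sim A B -> le_card A B.
Proof. intros H. exists B. split; [now intros x|exact H]. Qed.

Lemma le_card_trans A B C : le_card A B -> le_card B C -> le_card A C.
Proof.
  intros (W & I & H) (W' & I' & H').
  destruct (sim_subset B W' W H' I) as (W'' & I'' & H'').
  exists W''. split; [intros x Hx; auto|]. now apply sim_trans with W.
Qed.

Definition fin (A : M) : Prop :=
  forall F, empty ∊ F -> (forall B b, B ∊ F -> adjoin B b ∊ F) -> A ∊ F.

Lemma def_fin s k t : dterm s (S k) t -> def s (fun e => fin (t e)).
Proof.
  intros H. apply (def_subst s _ (fun _ => fin) t H). unfold fin, empty. strat.
Qed.

Lemma fin_empty : fin empty.
Proof. now intros F H _. Qed.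

Lemma fin_adjoin A a : fin A -> fin (adjoin A a).
Proof. intros H F H1 H2. apply H2, H; auto. Qed.

(** [expo X Y] reads |Y| = 2^|X|, with exponentiation of cardinals as in
    Specker's refutation of choice: 2^|USC(Z)| = |P(Z)|. *)
Definition expo (X Y : M) : Prop := exists Z, sim X (usc Z) /\ sim Y (pow Z).

Lemma def_expo s k t u :
  dterm s (S (S k)) t -> dterm s (S (S k)) u ->
  def s (fun e => expo (t e) (u e)).
Proof.
  intros Ht Hu. apply (def_subst2 s _ _ expo t u Ht Hu).
  unfold expo, sim, usc, pow, incl_set. strat.
Qed.

(** * Specker's sequence, with indices modulo 3 *)

Inductive color : Type := c0 | c1 | c2.

Definition next (c : color) : color :=
  match c with c0 => c1 | c1 => c2 | c2 => c0 end.

Definition pick (c : color) (A0 A1 A2 : M) : M :=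
  match c with c0 => A0 | c1 => A1 | c2 => A2 end.

Definition expo_closed (A B : M) : Prop :=
  forall X Y, X ∊ A -> expo X Y -> Y ∊ B.

(** [colored c X]: the cardinal of [X] is the [n]-th term of
    0, 2^0, 2^(2^0), ... for some [n] in the residue class [c] modulo 3. *)
Definition colored (c : color) (X : M) : Prop :=
  forall A0 A1 A2,
    empty ∊ A0 -> expo_closed A0 A1 -> expo_closed A1 A2 ->
    expo_closed A2 A0 -> X ∊ pick c A0 A1 A2.

(** A quantifier over colors lies outside the language, but is a conjunction of three formulas. *)
Lemma def_all_color s (P : color -> (nat -> M) -> Prop) :
  (forall c, def s (P c)) -> def s (fun e => forall c, P c e).
Proof.
  intros H. apply def_iff with (fun e => P c0 e /\ P c1 e /\ P c2 e).
  - intros e. split; [intros (H0 & H1 & H2) []; assumption|auto].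
  - repeat apply def_and; auto.
Qed.

Lemma def_ex_color s (P : color -> (nat -> M) -> Prop) :
  (forall c, def s (P c)) -> def s (fun e => exists c, P c e).
Proof.
  intros H. apply def_iff with (fun e => P c0 e \/ P c1 e \/ P c2 e).
  - intros e. split; [intros [|[]]; eauto|intros [[] ?]; auto].
  - repeat apply def_or; auto.
Qed.

Ltac strat_cards :=
  first [ strat_sets | simple eapply def_sim | simple eapply def_le_card
        | simple eapply def_fin | simple eapply def_expo
        | simple eapply def_all_color; intros ?
        | simple eapply def_ex_color; intros ? ].
Ltac strat_named ::= strat_cards.

Lemma def_colored c s k t :
  dterm s (S (S k)) t -> def s (fun e => colored c (t e)).
Proof.
  intros H. apply (def_subst s _ (fun _ => colored c) t H).
  unfold colored, expo_closed. destruct c; cbn [pick]; strat.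
Qed.

Ltac strat_named ::= first [ strat_cards | simple eapply def_colored ].

Lemma colored_empty : colored c0 empty.
Proof. now intros A0 A1 A2 H. Qed.

Lemma colored_next c X Y : colored c X -> expo X Y -> colored (next c) Y.
Proof.
  intros H E A0 A1 A2 H0 H1 H2 H3. specialize (H A0 A1 A2 H0 H1 H2 H3).
  destruct c; cbn in *; eauto.
Qed.

Lemma colored_ind (P : color -> M -> Prop) :
  (forall c, isset (P c)) -> P c0 empty ->
  (forall c X Y, P c X -> expo X Y -> P (next c) Y) ->
  forall c X, colored c X -> P c X.
Proof.
  intros HP H0 HS c X H.
  specialize (H (setof (P c0)) (setof (P c1)) (setof (P c2))).
  assert (N : forall c, expo_closed (setof (P c)) (setof (P (next c)))).
  { intros d Y Z HY HZ. rewrite in_setof in * by apply HP. eauto. }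
  replace (pick _ _ _ _) with (setof (P c)) in H by now destruct c.
  apply (in_setof (P c) X); [apply HP|].
  apply H; [rewrite in_setof by apply HP; exact H0|apply (N c0)|apply (N c1)
           |apply (N c2)].
Qed.

Lemma expo_sim X Y X' Y' : expo X Y -> sim X X' -> sim Y Y' -> expo X' Y'.
Proof.
  intros (Z & H1 & H2) HX HY. exists Z.
  split; eapply sim_trans; eauto using sim_sym.
Qed.

Lemma expo_functional X Y Y' : expo X Y -> expo X Y' -> sim Y Y'.
Proof.
  intros (Z & H1 & H2) (Z' & H1' & H2').
  apply sim_trans with (pow Z); [assumption|].
  apply sim_trans with (pow Z'); [|now apply sim_sym].
  apply sim_pow, sim_usc_inj. eapply sim_trans; eauto using sim_sym.
Qed.

(** The type shift commutes with exponentiation, because it commutes with power sets up to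
    equinumerosity. *)
Lemma expo_usc X Y : expo X Y -> expo (usc X) (usc Y).
Proof.
  intros (Z & H1 & H2). exists (usc Z). split; [now apply sim_usc|].
  apply sim_trans with (usc (pow Z)); [now apply sim_usc|apply sim_pow_usc].
Qed.

Lemma usc_empty : usc empty = empty.
Proof.
  apply ext. intros z. rewrite in_usc. split.
  - intros (y & Hy & _). now apply in_empty in Hy.
  - intros Hz. now apply in_empty in Hz.
Qed.

Lemma empty_in_pow A : empty ∊ pow A.
Proof. apply in_pow. intros t Ht. now apply in_empty in Ht. Qed.

Lemma empty_notin_usc A : ~ empty ∊ usc A.
Proof.
  intros (y & _ & E)%in_usc. apply (in_empty y). rewrite E. now apply in_sing.
Qed.

Lemma pow_inj A B : pow A = pow B -> A = B.
Proof.
  intros E. apply incl_antisym; apply in_pow; [rewrite <- E|rewrite E];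
    apply in_pow; now intros t.
Qed.

Lemma usc_pow_incl A : incl_set (usc A) (pow A).
Proof.
  intros u (x & Hx & ->)%in_usc. apply in_pow. now intros t ->%in_sing.
Qed.

(** The shift fixes the first term and commutes with passing to the next one, so residues are
    preserved by induction. *)
Lemma colored_usc c X : colored c X -> colored c (usc X).
Proof.
  apply (colored_ind (fun c X => colored c (usc X))).
  - intros d. set_exists.
  - rewrite usc_empty. apply colored_empty.
  - intros d Y Z H E. eapply colored_next; [exact H|]. now apply expo_usc.
Qed.

Lemma colored_inv c X :
  colored c X ->
  c = c0 /\ X = empty \/
  exists d, c = next d /\ exists X', colored d X' /\ expo X' X.
Proof.
  intros H.
  (* [colored] is carried along in the induction so that the predecessor is known to be colored. *)
  apply (colored_ind (fun c X => colored c X /\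
    (c = c0 /\ X = empty \/
     exists d, c = next d /\ exists X', colored d X' /\ expo X' X))) in H;
    [apply H|..].
  - intros d. set_exists.
  - split; [apply colored_empty|auto].
  - intros d Y Z [HY _] E. split; [now apply colored_next with Y|]. eauto 8.
Qed.

Lemma colored_sim c X X' : colored c X -> sim X X' -> colored c X'.
Proof.
  intros H S. apply colored_inv in H as [[-> ->]|(d & -> & Y & HY & E)].
  - apply sim_sym, sim_empty in S as ->. apply colored_empty.
  - apply colored_next with Y; [exact HY|].
    apply expo_sim with Y X; auto using sim_refl.
Qed.

Definition last (X : M) : Prop := forall Y, ~ expo X Y.

(** Two last terms of the sequence agree, since by induction every term has
    each last term among its successors. *)
Lemma last_unique c d L L' :
  colored c L -> colored d L' -> last L -> last L' -> sim L' L.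
Proof.
  intros HL HL' E E'.
  (* [leads X]: iterated exponentiation reaches [L] from [X], up to equinumerosity. *)
  pose (leads X := forall A, X ∊ A -> (forall U W, U ∊ A -> sim U W -> W ∊ A) ->
                     expo_closed A A -> L ∊ A).
  assert (H : forall c X, colored c X -> leads X).
  { apply (colored_ind (fun _ => leads)).
    - intros _. unfold leads, expo_closed. set_exists.
    - intros A H0 _ HA.
      apply (colored_ind (fun _ X => X ∊ A)) in HL; auto.
      intros _. set_exists.
    - intros _ X Y HX EX A HY HA1 HA2.
      (* With the cardinal of [X] added, a closed family containing [Y] becomes a closed family
         containing [X], hence [L]; and [L] is not equinumerous with [X], which has a successor. *)
      assert (isset (fun U => U ∊ A \/ sim X U)) as [A' HA'] by set_exists.
      assert (HLA : L ∊ A').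
      { apply HX.
        - apply HA'. right. apply sim_refl.
        - intros U W. rewrite !HA'. intros [HU|HU] S; [left; eauto|].
          right. now apply sim_trans with U.
        - intros U W. rewrite !HA'. intros [HU|HU] EU; [left; eauto|].
          left. apply HA1 with Y; [exact HY|].
          apply expo_functional with U; [|exact EU].
          apply expo_sim with X Y; auto using sim_refl. }
      apply HA' in HLA as [?|S]; [assumption|].
      destruct (E Y). apply expo_sim with X Y; auto using sim_refl. }
  (* Since [L'] is last, its cardinal alone is a closed family, and this must contain [L]. *)
  assert (isset (fun U => sim L' U)) as [A HA] by set_exists.
  apply HA, (H d L' HL' A).
  - apply HA, sim_refl.
  - intros U W. rewrite !HA. eauto using sim_trans.
  - intros U W. rewrite !HA. intros S EU.
    destruct (E' W). apply expo_sim with U W; auto using sim_sym, sim_refl.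
Qed.

(** * Refutation of a finite universe *)

Section FiniteUniverse.
Context (univ_fin : fin univ).

(** Induction on the universe, for the property that all subsets are finite: a subset of
    [adjoin B b] is its part in [B], possibly with [b] added. *)
Lemma fin_all A : fin A.
Proof.
  assert (isset (fun X => forall Y, incl_set Y X -> fin Y))
    as [F HF] by set_exists.
  assert (H : univ ∊ F).
  { apply univ_fin.
    - apply HF. intros Y I. replace Y with empty; [apply fin_empty|].
      apply incl_antisym; [|exact I]. intros t Ht. now apply in_empty in Ht.
    - intros B b HB. rewrite HF in *. intros Y I.
      assert (HR : fin (setof (fun x => x ∊ Y /\ x ∊ B))).
      { apply HB. intros x. rewrite in_setof by set_exists. tauto. }
      destruct (classic (b ∊ Y)) as [Hb|Hb].
      + apply (fin_adjoin _ b) in HR.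
        replace Y with (adjoin (setof (fun x => x ∊ Y /\ x ∊ B)) b);
          [exact HR|].
        apply ext. intros z. rewrite in_adjoin, in_setof by set_exists.
        split; [now intros [[? _]| ->]|].
        intros Hz. apply I in Hz as Hz'. rewrite in_adjoin in Hz'. tauto.
      + apply HB. intros x Hx. apply I in Hx as Hx'.
        apply in_adjoin in Hx' as [?| ->]; [assumption|contradiction]. }
  rewrite HF in H. apply H. intros x _. apply in_univ.
Qed.

Lemma fin_set_ind (P : M -> Prop) :
  isset P -> P empty -> (forall A a, P A -> ~ a ∊ A -> P (adjoin A a)) ->
  forall A, P A.
Proof.
  intros HP H0 HS A. pose proof (fin_all A (setof P)) as H.
  rewrite !in_setof in H by exact HP. apply H; [exact H0|].
  intros B b. rewrite !in_setof by exact HP. intros HB.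
  destruct (classic (b ∊ B)) as [Hb|Hb]; [|auto].
  replace (adjoin B b) with B; [exact HB|].
  apply ext. intros z. rewrite in_adjoin. split; [auto|].
  now intros [?| ->].
Qed.

(** Induction on [A]: an injection of [A] into [B] either exhausts [B] or misses some [b], to which
    the new element can be sent. *)
Lemma le_card_total A B : le_card A B \/ le_card B A.
Proof.
  revert A B.
  apply (fin_set_ind (fun A => forall B, le_card A B \/ le_card B A)).
  - set_exists.
  - intros B. left. apply incl_le_card. intros t Ht. now apply in_empty in Ht.
  - intros A a IH Ha B. destruct (IH B) as [(W & I & S)|H].
    + destruct (classic (incl_set B W)) as [J|J].
      * right. apply le_card_trans with A.
        -- rewrite (incl_antisym B W J I). now apply sim_le_card, sim_sym.
        -- apply incl_le_card. intros x Hx. apply in_adjoin. auto.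
      * left. apply not_all_ex_not in J as [b Hb].
        apply imply_to_and in Hb as [Hb Nb].
        exists (adjoin W b). split; [|now apply sim_adjoin].
        intros x [Hx| ->]%in_adjoin; auto.
    + right. apply le_card_trans with A; [exact H|].
      apply incl_le_card. intros x Hx. apply in_adjoin. auto.
Qed.

Lemma dedekind_finite A : forall W, sim A W -> incl_set W A -> W = A.
Proof.
  revert A.
  apply (fin_set_ind (fun A => forall W, sim A W -> incl_set W A -> W = A)).
  - set_exists.
  - intros W S _. apply sim_sym in S. now apply sim_empty.
  - intros A a IH Ha W S I.
    assert (HR : forall b, b ∊ W -> incl_set (remove W b) A -> remove W b = A).
    { intros b Hb J. apply IH; [|exact J]. now apply sim_remove with a. }
    destruct (classic (a ∊ W)) as [HaW|HaW].
    + assert (E : remove W a = A).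
      { apply HR; [exact HaW|]. intros x [Hx N]%in_remove.
        apply I, in_adjoin in Hx as [?|?]; [assumption|contradiction]. }
      apply ext. intros z. rewrite in_adjoin, <- E, in_remove.
      split; [|now intros [[? _]| ->]].
      intros Hz. destruct (classic (z = a)); auto.
    + assert (J : incl_set W A).
      { intros x Hx. apply I in Hx as Hx'.
        apply in_adjoin in Hx' as [?| ->]; [assumption|contradiction]. }
      (* [W] is nonempty, as [a] has an image [b] in it. Removing [b] would leave exactly [A], yet
         [b] is in [A]. *)
      destruct S as (r & H & _). destruct (H a) as (b & Hb & _).
      { apply in_adjoin. auto. }
      exfalso. assert (E : remove W b = A).
      { apply HR; [exact Hb|]. intros x [Hx _]%in_remove. auto. }
      apply J in Hb. rewrite <- E in Hb. now apply in_remove in Hb.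
Qed.

Lemma le_card_incl A B : le_card A B -> incl_set B A -> A = B.
Proof.
  intros (W & I & S) J. assert (E : W = A).
  { apply dedekind_finite; [exact S|]. intros x Hx. auto. }
  subst W. now apply incl_antisym.
Qed.

(** By totality one may take [A] equinumerous with a subset W of [B]. Then P(W) is a subset of P(B)
    of the same cardinality, so Dedekind finiteness gives P(W) = P(B) and W = B. *)
Lemma sim_pow_inj A B : sim (pow A) (pow B) -> sim A B.
Proof.
  assert (H : forall A B, le_card A B -> sim (pow A) (pow B) -> sim A B).
  { clear A B. intros A B (W & I & S) H.
    replace B with W; [exact S|]. apply pow_inj, dedekind_finite.
    - apply sim_trans with (pow A); [now apply sim_sym|now apply sim_pow].
    - intros x. rewrite !in_pow. intros Hx t Ht. auto. }
  intros S. destruct (le_card_total A B) as [L|L]; [auto|].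
  apply sim_sym, H; [exact L|now apply sim_sym].
Qed.

Lemma expo_injective X X' Y : expo X Y -> expo X' Y -> sim X X'.
Proof.
  intros (Z & H1 & H2) (Z' & H1' & H2').
  apply sim_trans with (usc Z); [assumption|].
  apply sim_trans with (usc Z'); [|now apply sim_sym].
  apply sim_usc, sim_pow_inj. eapply sim_trans; eauto using sim_sym.
Qed.

Lemma not_expo_empty X : ~ expo X empty.
Proof.
  intros (Z & _ & S). apply sim_sym, sim_empty in S.
  apply (in_empty empty). rewrite <- S at 2. apply empty_in_pow.
Qed.

(** The empty set is no exponential, and predecessors are unique up to equinumerosity by
    [expo_injective]; so the residue is determined by the cardinal. *)
Lemma colored_unique c d X : colored c X -> colored d X -> c = d.
Proof.
  intros H Hd. apply (colored_ind (fun c X =>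
    colored c X /\ forall d, colored d X -> c = d)) in H; [now apply H|..].
  - intros c'. set_exists.
  - split; [apply colored_empty|].
    intros d' [[-> _]|(d'' & _ & X' & _ & E)]%colored_inv; [reflexivity|].
    now apply not_expo_empty in E.
  - intros c' Y Z [HY U] E. split; [now apply colored_next with Y|].
    intros d' [[-> ->]|(d'' & -> & X' & H' & E')]%colored_inv.
    + now apply not_expo_empty in E.
    + f_equal. apply U. apply colored_sim with X'; [exact H'|].
      now apply expo_injective with Z.
Qed.

Lemma max_card A : (exists X, X ∊ A) ->
  exists X, X ∊ A /\ forall Y, Y ∊ A -> le_card Y X.
Proof.
  revert A. apply (fin_set_ind (fun A => (exists X, X ∊ A) ->
    exists X, X ∊ A /\ forall Y, Y ∊ A -> le_card Y X)).
  - set_exists.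
  - intros [X HX]. now apply in_empty in HX.
  - intros A a IH Ha _. destruct (classic (exists X, X ∊ A)) as [N|N].
    + destruct (IH N) as (X & HX & HM).
      destruct (le_card_total X a) as [L|L].
      * exists a. rewrite in_adjoin. split; [auto|].
        intros Y [HY| ->]%in_adjoin.
        -- now apply le_card_trans with X; auto.
        -- apply sim_le_card, sim_refl.
      * exists X. rewrite in_adjoin. split; [auto|].
        intros Y [HY| ->]%in_adjoin; auto.
    + exists a. rewrite in_adjoin. split; [auto|].
      intros Y [HY| ->]%in_adjoin; [destruct N; eauto|].
      apply sim_le_card, sim_refl.
Qed.

(** The terms form a finite set, so one has greatest cardinality. A term after it would give |P(Z)|
    <= |USC(Z)|, whereas USC(Z) is a proper subset of the finite set P(Z). *)
Lemma last_exists : exists c L, colored c L /\ last L.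
Proof.
  destruct (max_card (setof (fun X => exists c, colored c X)))
    as (L & HL & HM).
  - exists empty. rewrite in_setof by set_exists. exists c0.
    apply colored_empty.
  - rewrite in_setof in HL by set_exists. destruct HL as [c HL].
    exists c, L. split; [exact HL|]. intros Y E.
    assert (HY : le_card Y L).
    { apply HM. rewrite in_setof by set_exists. exists (next c).
      now apply colored_next with L. }
    destruct E as (Z & H1 & H2). apply (empty_notin_usc Z).
    rewrite <- (le_card_incl (pow Z) (usc Z)).
    + apply empty_in_pow.
    + apply le_card_trans with Y; [now apply sim_le_card, sim_sym|].
      apply le_card_trans with L; [exact HY|now apply sim_le_card].
    + apply usc_pow_incl.
Qed.

(** Otherwise [L] would be equinumerous with a set of singletons and have an exponential. *)
Lemma usc_univ_le_last L : last L -> le_card (usc univ) L.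
Proof.
  intros H. destruct (le_card_total (usc univ) L) as [?|(W & I & S)];
    [assumption|].
  destruct (sim_usc_univ_subset L W S I) as [Z HZ].
  destruct (H (pow Z)). exists Z. split; [exact HZ|apply sim_refl].
Qed.

Lemma pow_univ : pow univ = univ.
Proof.
  apply ext. intros z. rewrite in_pow. split; intros _; [apply in_univ|].
  intros t _. apply in_univ.
Qed.

(** An exponential would make the universe equinumerous with a set of singletons, hence equal to it
    by Dedekind finiteness; but the empty set is no singleton. *)
Lemma last_univ : last univ.
Proof.
  intros Y (W & S & _). apply (empty_notin_usc W).
  rewrite (dedekind_finite univ (usc W)).
  - apply in_univ.
  - exact S.
  - intros x _. apply in_univ.
Qed.

(** [Y] turns out to be equinumerous with P(V) = V, which is last. *)
Lemma last_expo_pow_last L Y : last L -> expo (pow L) Y -> last Y.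
Proof.
  intros HL (Z & H1 & H2).
  (* |USC(V)| = |USC(P(V))| = |P(USC(V))| <= |P(L)| = |USC(Z)| *)
  assert (HZ : Z = univ).
  { apply incl_antisym; [intros x _; apply in_univ|].
    assert (E : usc Z = usc univ).
    { symmetry. apply le_card_incl.
      - destruct (usc_univ_le_last L HL) as (W & I & S).
        apply le_card_trans with (pow W).
        + apply sim_le_card. rewrite <- pow_univ at 1.
          apply sim_trans with (pow (usc univ)); [apply sim_pow_usc|].
          now apply sim_pow.
        + apply le_card_trans with (pow L); [|now apply sim_le_card].
          apply incl_le_card. intros x. rewrite !in_pow. intros Hx t Ht. auto.
      - intros x (y & _ & ->)%in_usc. apply sing_in_usc, in_univ. }
    intros x Hx. apply sing_in_usc. rewrite E. now apply sing_in_usc. }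
  subst Z. rewrite pow_univ in H2. intros X E. apply (last_univ X).
  apply expo_sim with Y X; auto using sim_refl.
Qed.

Lemma fin_univ_absurd : False.
Proof.
  destruct last_exists as (c & L & HL & E).
  (* P(L) is the exponential of USC(L), which has the color of [L]. *)
  assert (HP : colored (next c) (pow L)).
  { apply colored_next with (usc L); [now apply colored_usc|].
    exists L. split; apply sim_refl. }
  assert (U : forall d X, colored d X -> last X -> d = c).
  { intros d X HX EX. apply colored_unique with L; [|exact HL].
    apply colored_sim with X; [exact HX|].
    now apply (last_unique c d). }
  (* A last term would have color [next c] or [next (next c)]; modulo 3 both differ from [c]. *)
  destruct (classic (last (pow L))) as [H|H].
  - apply U in HP; [|exact H]. now destruct c.
  - apply not_all_ex_not in H as [Y H]. apply NNPP in H.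
    specialize (U (next (next c)) Y).
    enough (next (next c) = c) by now destruct c.
    apply U; [now apply colored_next with (pow L)|].
    now apply last_expo_pow_last with L.
Qed.

End FiniteUniverse.
(** * Church numbers *)

Definition idset : M := setof (fun u => exists x, u = pair x x).
Definition zero : M := setof (fun u => exists f, u = pair f idset).
(** The composition of [f] after the value of [z] at [f], in Church's notation the function sending
    x to f(zfx). *)
Definition step (f z : M) : M :=
  setof (fun u => exists x w t q,
    u = pair x w /\ func t /\ pair f t ∊ z /\ pair x q ∊ t /\ pair q w ∊ f).
Definition succ (z : M) : M :=
  setof (fun v => exists f, v = pair f (step f z) /\ func f).
Definition Succ : M := setof (fun v => exists z, v = pair z (succ z) /\ func z).
Definition ap (f x : M) : M :=
  setof (fun t => exists y, pair x y ∊ f /\ t ∊ y).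
Definition Nat : M :=
  setof (fun n => forall X,
    zero ∊ X /\ (forall m, m ∊ X -> ap Succ m ∊ X) -> n ∊ X).

(** A relation between objects of index [k] has index [k + 3]; a relation between such relations, as
    Church numbers are, has index [k + 6]. *)
Lemma dterm_step s k f z :
  dterm s (S (S (S k))) f -> dterm s (S (S (S (S (S (S k)))))) z ->
  dterm s (S (S (S k))) (fun e => step (f e) (z e)).
Proof.
  intros Hf Hz. apply (dterm_subst2 s _ _ _ step f z Hf Hz). unfold step. strat.
Qed.

(** Successor preserves the index, so inductions that mention [succ n] beside [n] can be
    stratified. *)
Lemma dterm_succ s k z :
  dterm s (S (S (S (S (S (S k)))))) z ->
  dterm s (S (S (S (S (S (S k)))))) (fun e => succ (z e)).
Proof.
  intros Hz. apply (dterm_subst s _ _ succ z Hz). unfold succ, step. strat.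
Qed.

Lemma dterm_ap s k f x :
  dterm s (S (S (S (S k)))) f -> dterm s (S k) x ->
  dterm s (S k) (fun e => ap (f e) (x e)).
Proof.
  intros Hf Hx. apply (dterm_subst2 s _ _ _ ap f x Hf Hx). unfold ap. strat.
Qed.

Ltac strat_named ::=
  first [ strat_sets | simple eapply def_fin | simple eapply dterm_step
        | simple eapply dterm_succ | simple eapply dterm_ap ].

Lemma pair_in_zero f t : pair f t ∊ zero <-> t = idset.
Proof.
  unfold zero. rewrite in_setof by set_exists. split.
  - now intros (f' & [_ ->]%pair_inj).
  - intros ->. eauto.
Qed.

Lemma pair_in_id x y : pair x y ∊ idset <-> x = y.
Proof.
  unfold idset. rewrite in_setof by set_exists. split.
  - now intros (z & [-> ->]%pair_inj).
  - intros ->. eauto.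
Qed.

Lemma pair_in_step f z x w :
  pair x w ∊ step f z <->
  exists t q, func t /\ pair f t ∊ z /\ pair x q ∊ t /\ pair q w ∊ f.
Proof.
  unfold step. rewrite in_setof by set_exists. split.
  - intros (x' & w' & t & q & [-> ->]%pair_inj & H). eauto.
  - intros (t & q & H). eauto 8.
Qed.

Lemma pair_in_succ f t z : pair f t ∊ succ z <-> func f /\ t = step f z.
Proof.
  unfold succ. rewrite in_setof by set_exists. split.
  - now intros (f' & [-> ->]%pair_inj & H).
  - intros [H ->]. eauto.
Qed.

Lemma func_succ z : func (succ z).
Proof.
  intros f t t'. rewrite !pair_in_succ. intros [_ ->] [_ ->]. reflexivity.
Qed.

Lemma ap_unique f x y : func f -> pair x y ∊ f -> ap f x = y.
Proof.
  intros Hf H. apply ext. intros z. unfold ap. rewrite in_setof by set_exists.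
  split; [|eauto]. intros (y' & H' & Hz). now rewrite (Hf x y y').
Qed.

Lemma pair_in_Succ z s : pair z s ∊ Succ <-> func z /\ s = succ z.
Proof.
  unfold Succ. rewrite in_setof by set_exists. split.
  - now intros (z' & [-> ->]%pair_inj & H).
  - intros [H ->]. eauto.
Qed.

Lemma ap_Succ z : func z -> ap Succ z = succ z.
Proof.
  intros Hz. apply ap_unique; [|now apply pair_in_Succ].
  intros x s s'. rewrite !pair_in_Succ. intros [_ ->] [_ ->]. reflexivity.
Qed.

Lemma in_Nat n :
  n ∊ Nat <->
  forall X, zero ∊ X /\ (forall m, m ∊ X -> ap Succ m ∊ X) -> n ∊ X.
Proof. unfold Nat. now rewrite in_setof by set_exists. Qed.

Lemma Nat_func n : n ∊ Nat -> func n.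
Proof.
  rewrite in_Nat. intros H.
  assert (isset func) as [X HX] by set_exists.
  apply HX, H. split.
  - apply HX. intros f t t'. rewrite !pair_in_zero. congruence.
  - intros m. rewrite !HX. intros Hm. rewrite ap_Succ by exact Hm.
    apply func_succ.
Qed.

Lemma zero_Nat : zero ∊ Nat.
Proof. apply in_Nat. now intros X [H _]. Qed.

Lemma succ_Nat n : n ∊ Nat -> succ n ∊ Nat.
Proof.
  intros Hn. apply in_Nat. intros X H. rewrite <- ap_Succ by now apply Nat_func.
  apply H. now apply in_Nat.
Qed.

Lemma Nat_induction (P : M -> Prop) :
  isset P -> P zero -> (forall n, n ∊ Nat -> P n -> P (succ n)) ->
  forall n, n ∊ Nat -> P n.
Proof.
  intros [Y HY] H0 HS n Hn.
  assert (isset (fun n => n ∊ Nat /\ n ∊ Y)) as [X HX] by set_exists.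
  apply HY, HX. rewrite in_Nat in Hn. apply Hn.
  split; [apply HX; split; [apply zero_Nat|now apply HY]|].
  intros m. rewrite !HX. intros [Hm Hm'].
  rewrite ap_Succ by now apply Nat_func.
  split; [now apply succ_Nat|]. rewrite HY in *. auto.
Qed.

(** Needed because [step] admits only values that are functions; by this lemma iteration never stops
    for lack of such a value. *)
Lemma Nat_value n : n ∊ Nat ->
  forall f, func f -> exists t, func t /\ pair f t ∊ n.
Proof.
  revert n. apply (Nat_induction (fun n =>
    forall f, func f -> exists t, func t /\ pair f t ∊ n)).
  - set_exists.
  - intros f _. exists idset. split; [|now apply pair_in_zero].
    intros x y z. rewrite !pair_in_id. congruence.
  - intros n Hn IH f Hf. exists (step f n).
    split; [|now apply pair_in_succ].
    intros x w w'. rewrite !pair_in_step.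
    intros (t & q & Ht & H1 & H2 & H3) (t' & q' & _ & H1' & H2' & H3').
    rewrite (Nat_func n Hn f t' t) in H2' by assumption.
    rewrite (Ht x q' q) in H3' by assumption.
    now apply (Hf q).
Qed.

(** Reads f^n(x) = y for a possibly partial function [f]. *)
Definition iter (n f x y : M) : Prop := exists t, pair f t ∊ n /\ pair x y ∊ t.

Lemma iter_zero f x y : iter zero f x y <-> x = y.
Proof.
  unfold iter. setoid_rewrite pair_in_zero. split.
  - intros (t & -> & H). now apply pair_in_id.
  - intros H. exists idset. now rewrite pair_in_id.
Qed.

Lemma iter_succ n f x y : n ∊ Nat -> func f ->
  (iter (succ n) f x y <-> exists q, iter n f x q /\ pair q y ∊ f).
Proof.
  intros Hn Hf. unfold iter. split.
  - intros (p & [_ ->]%pair_in_succ & (t & q & H)%pair_in_step).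
    exists q. split; [exists t|]; tauto.
  - intros (q & (t & Ht & Hx) & Hq). exists (step f n).
    rewrite pair_in_succ, pair_in_step. repeat split; auto.
    exists t, q. repeat split; auto.
    destruct (Nat_value n Hn f Hf) as (t' & Ft & Ht').
    now rewrite (Nat_func n Hn f t t').
Qed.

(** * Finite functions with an iteration of exactly given length *)

Lemma not_fin_univ : ~ fin univ.
Proof. exact fin_univ_absurd. Qed.

(** The finite field [A] and the end point [l], at which [f] is undefined, are recorded so that the
    path can be prolonged. *)
Definition path (n f A x l : M) : Prop :=
  func f /\ (forall u v, pair u v ∊ f -> u ∊ A /\ v ∊ A) /\ fin A /\
  l ∊ A /\ (forall v, ~ pair l v ∊ f) /\ iter n f x l /\
  (forall u v, ~ iter (succ n) f u v).

Lemma path_zero : exists f A x l, path zero f A x l.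
Proof.
  (* The empty function on a single point, here the empty set. *)
  exists empty, (adjoin empty empty), empty, empty.
  assert (H : forall u v, ~ pair u v ∊ empty) by (intros; apply in_empty).
  assert (F : func empty) by (intros x y z Hx; now apply H in Hx).
  split; [exact F|]. split; [intros u v Hu; now apply H in Hu|].
  split; [apply fin_adjoin, fin_empty|].
  split; [apply in_adjoin; auto|].
  split; [apply H|]. split; [now apply iter_zero|].
  intros u v. rewrite iter_succ by auto using zero_Nat.
  intros (q & _ & Hq). now apply H in Hq.
Qed.

Lemma iter_mono f g x : func f -> func g ->
  (forall u v, pair u v ∊ f -> pair u v ∊ g) ->
  forall n, n ∊ Nat -> forall y, iter n f x y -> iter n g x y.
Proof.
  intros Hf Hg I.
  apply (Nat_induction (fun n => forall y, iter n f x y -> iter n g x y)).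
  - unfold iter. set_exists.
  - intros y. now rewrite !iter_zero.
  - intros n Hn IH y. rewrite !iter_succ by assumption.
    intros (q & Hq & Hy). eauto.
Qed.

Lemma path_succ n : n ∊ Nat ->
  (exists f A x l, path n f A x l) -> exists f A x l, path (succ n) f A x l.
Proof.
  intros Hn (f & A & x & l & Ff & FA & Fin & Hl & Sl & Hx & Hmax).
  assert (Hb : exists b, ~ b ∊ A).
  { apply NNPP. intros N. apply not_fin_univ. replace univ with A; [exact Fin|].
    apply incl_antisym; [intros z _; apply in_univ|].
    intros z _. apply NNPP. eauto. }
  destruct Hb as [b Hb].
  (* The path is prolonged from its end [l] to the new point [b]. *)
  set (g := adjoin f (pair l b)).
  assert (Hg : forall u v, pair u v ∊ g <-> pair u v ∊ f \/ u = l /\ v = b).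
  { intros u v. unfold g. rewrite in_adjoin. split.
    - intros [H|[-> ->]%pair_inj]; auto.
    - intros [H|[-> ->]]; auto. }
  assert (Fg : func g).
  { intros u v w. rewrite !Hg. intros [H|[-> ->]] [H'|[E ->]].
    - now apply (Ff u).
    - subst. now apply Sl in H.
    - now apply Sl in H'.
    - reflexivity. }
  (* No arrow of [g] leaves [b], so an iteration of [g] that ends elsewhere has never met [b] after
     its start and uses only arrows of [f]. *)
  assert (Back : forall m, m ∊ Nat -> forall u v, iter m g u v -> v <> b ->
                 iter m f u v).
  { apply (Nat_induction (fun m => forall u v, iter m g u v -> v <> b ->
                                   iter m f u v)).
    - unfold iter. set_exists.
    - intros u v. now rewrite !iter_zero.
    - intros m Hm IH u v. rewrite !iter_succ by assumption.
      intros (q & Hq & Hv) N. apply Hg in Hv as [Hv|[_ ->]]; [|contradiction].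
      exists q. split; [|exact Hv]. apply IH; [exact Hq|].
      intros ->. now apply FA in Hv. }
  exists g, (adjoin A b), x, b.
  split; [exact Fg|]. split.
  { intros u v. rewrite Hg, !in_adjoin.
    intros [H|[-> ->]]; [apply FA in H; tauto|auto]. }
  split; [now apply fin_adjoin|]. split; [apply in_adjoin; auto|]. split.
  { intros v. rewrite Hg.
    intros [H|[-> _]]; [now apply FA in H|contradiction]. }
  split.
  - apply iter_succ; auto. exists l. split; [|apply Hg; auto].
    apply (iter_mono f g x Ff Fg); auto. intros u v. rewrite Hg. auto.
  - intros u v. rewrite iter_succ by auto using succ_Nat.
    (* The last arrow starts at [q], so [q] is not [b]; the preceding iteration would then be one of
       [f], too long by [Hmax]. *)
    intros (q & Hq & Hv). apply (Hmax u q). apply Back; auto using succ_Nat.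
    intros ->.
    apply Hg in Hv as [Hv|[-> _]]; [now apply FA in Hv|contradiction].
Qed.

Lemma path_exists n : n ∊ Nat -> exists f A x l, path n f A x l.
Proof.
  revert n. apply (Nat_induction (fun n => exists f A x l, path n f A x l)).
  - unfold path, iter. set_exists.
  - apply path_zero.
  - exact path_succ.
Qed.

(** * The order of Church numbers, and injectivity of successor *)

Definition nle (m n : M) : Prop :=
  forall X, m ∊ X -> (forall k, k ∊ Nat -> k ∊ X -> succ k ∊ X) -> n ∊ X.

Lemma nle_refl n : nle n n.
Proof. now intros X H _. Qed.

Lemma nle_succ m n : n ∊ Nat -> nle m n -> nle m (succ n).
Proof. intros Hn H X H1 H2. apply H2, H; auto. Qed.

Lemma nle_cases m n : nle m n -> m = n \/ nle (succ m) n.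
Proof.
  intros H. assert (isset (fun k => m = k \/ nle (succ m) k)) as [X HX].
  { unfold nle. set_exists. }
  apply HX, H.
  - apply HX. auto.
  - intros k Hk. rewrite !HX. intros [->|L]; right; [apply nle_refl|].
    now apply nle_succ.
Qed.

Lemma nle_zero n : n ∊ Nat -> nle zero n.
Proof.
  revert n. apply (Nat_induction (nle zero)).
  - unfold nle. set_exists.
  - apply nle_refl.
  - intros n. apply nle_succ.
Qed.

Lemma nle_total m : m ∊ Nat -> forall n, n ∊ Nat -> nle m n \/ nle n m.
Proof.
  intros Hm. apply (Nat_induction (fun n => nle m n \/ nle n m)).
  - unfold nle. set_exists.
  - right. now apply nle_zero.
  - intros n Hn [H|H]; [left; now apply nle_succ|].
    apply nle_cases in H as [->|H]; [|now right].
    left. apply nle_succ; [exact Hn|apply nle_refl].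
Qed.

(** Take [f] with f^(m+1) nonempty and f^(m+2) empty. Emptiness persists up the order, so f^(n+1) is
    empty while f^(m+1) is not. *)
Lemma not_nle_succ m n :
  m ∊ Nat -> n ∊ Nat -> nle (succ m) n -> succ m <> succ n.
Proof.
  intros Hm Hn L E.
  destruct (path_exists (succ m)) as
    (f & A & x & l & Ff & _ & _ & _ & _ & Hx & Hmax);
    [now apply succ_Nat|].
  assert (isset (fun k => forall u v, ~ iter (succ k) f u v)) as [X HX].
  { unfold iter. set_exists. }
  assert (H : n ∊ X).
  { apply L.
    - now apply HX.
    - intros k Hk. rewrite !HX. intros H u v.
      rewrite iter_succ by auto using succ_Nat.
      intros (q & Hq & _). now apply H in Hq. }
  rewrite HX in H. apply (H x l). now rewrite <- E.
Qed.

Lemma succ_inj m n : m ∊ Nat -> n ∊ Nat -> succ m = succ n -> m = n.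
Proof.
  intros Hm Hn E. apply NNPP. intros N.
  destruct (nle_total m Hm n Hn) as [[?|L]%nle_cases|[?|L]%nle_cases];
    try congruence.
  - now apply (not_nle_succ m n).
  - now apply (not_nle_succ n m).
Qed.

(** Some [f] has f^(n+1) empty, while f^0 is the identity. *)
Lemma zero_not_succ n : n ∊ Nat -> zero <> succ n.
Proof.
  intros Hn E. destruct (path_exists n Hn) as (f & A & x & l & Ff & H).
  apply (proj2 (proj2 (proj2 (proj2 (proj2 H)))) x x).
  rewrite <- E. now apply iter_zero.
Qed.
(** * Reading the named formulas in a model *)

(** Under [d] quantifiers, the variable named [x] has the value [a]. *)
Definition names (e : nat -> M) (d : nat) (x : var) (a : M) : Prop :=
  x < d /\ e (d - S x) = a.

Definition reads (e : nat -> M) (d : nat) (p : pform) (P : Prop) : Prop :=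
  sat mem e (p d) <-> P.

Lemma names_new e d a : names (scons a e) (S d) d a.
Proof. split; [lia|]. now rewrite Nat.sub_diag. Qed.

Lemma names_old e d x a b : names e d x b -> names (scons a e) (S d) x b.
Proof.
  intros [L <-]. split; [lia|].
  now replace (S d - S x) with (S (d - S x)) by lia.
Qed.

Lemma reads_iff e d p P Q : reads e d p P -> (P <-> Q) -> reads e d p Q.
Proof. unfold reads. tauto. Qed.

Lemma reads_eq e d x y a b :
  names e d x a -> names e d y b -> reads e d (x ≐ y) (a = b).
Proof. now intros [_ <-] [_ <-]. Qed.

Lemma reads_mem e d x y a b :
  names e d x a -> names e d y b -> reads e d (x ∈ y) (a ∊ b).
Proof. now intros [_ <-] [_ <-]. Qed.

Lemma reads_not e d p P : reads e d p P -> reads e d (¬ p) (~ P).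
Proof. unfold reads. cbn. tauto. Qed.

Lemma reads_imp e d p q P Q :
  reads e d p P -> reads e d q Q -> reads e d (p ⇒ q) (P -> Q).
Proof. unfold reads. cbn. tauto. Qed.

Lemma reads_and e d p q P Q :
  reads e d p P -> reads e d q Q -> reads e d (p ∧ q) (P /\ Q).
Proof. unfold reads. cbn. tauto. Qed.

Lemma reads_or e d p q P Q :
  reads e d p P -> reads e d q Q -> reads e d (p ∨ q) (P \/ Q).
Proof. unfold reads. cbn. tauto. Qed.

Lemma reads_equiv e d p q P Q :
  reads e d p P -> reads e d q Q -> reads e d (p ⇔ q) (P <-> Q).
Proof. unfold reads. cbn. tauto. Qed.

Lemma reads_all e d p P :
  (forall a, reads (scons a e) (S d) (p d) (P a)) ->
  reads e d (pAll p) (forall a, P a).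
Proof. intros H. split; intros F a; apply H, F. Qed.

Lemma reads_ex e d p P :
  (forall a, reads (scons a e) (S d) (p d) (P a)) ->
  reads e d (pEx p) (exists a, P a).
Proof.
  intros H. unfold reads. cbn. split.
  - intros F. apply NNPP. intros N. apply F. intros a Ha. apply N.
    exists a. apply H, Ha.
  - intros [a Ha] F. apply (F a), H, Ha.
Qed.

Ltac read_named := fail.

Ltac read_name :=
  first [ eassumption | apply names_new | apply names_old; read_name ].

Ltac read_step :=
  lazymatch goal with
  | |- names _ _ _ _ => read_name
  | |- reads _ _ (pEq _ _) _ => eapply reads_eq
  | |- reads _ _ (pMem _ _) _ => eapply reads_mem
  | |- reads _ _ (pNeg _) _ => eapply reads_not
  | |- reads _ _ (pImp _ _) _ => eapply reads_imp
  | |- reads _ _ (pAnd _ _) _ => eapply reads_and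
  | |- reads _ _ (pOr _ _) _ => eapply reads_or
  | |- reads _ _ (pIff _ _) _ => eapply reads_equiv
  | |- reads _ _ (pAll _) _ => eapply reads_all; intros ?; cbv beta
  | |- reads _ _ (pEx _) _ => eapply reads_ex; intros ?; cbv beta
  | |- reads _ _ _ _ => read_named
  end.

Ltac read := intros; eapply reads_iff; [repeat read_step|cbv beta].

(** Links the formulas [is_t a], which list the elements of [a], with equality to the set term. *)
Lemma eq_setof P X : isset P -> (X = setof P <-> forall x, x ∊ X <-> P x).
Proof.
  intros H. split; [|apply setof_unique]. intros -> x. now apply in_setof.
Qed.

Lemma reads_singleton e d a x A X :
  names e d a A -> names e d x X -> reads e d (is_singleton a x) (A = sing X).
Proof.
  unfold is_singleton. read. unfold sing. now rewrite eq_setof by set_exists.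
Qed.

Lemma reads_unordered_pair e d a x y A X Y :
  names e d a A -> names e d x X -> names e d y Y ->
  reads e d (is_unordered_pair a x y) (A = upair X Y).
Proof.
  unfold is_unordered_pair. read. unfold upair.
  now rewrite eq_setof by set_exists.
Qed.

Ltac read_named ::=
  first [ eapply reads_singleton | eapply reads_unordered_pair ].

Lemma reads_pair e d p x y P X Y :
  names e d p P -> names e d x X -> names e d y Y ->
  reads e d (is_pair p x y) (P = pair X Y).
Proof.
  unfold is_pair. read. unfold pair. now rewrite eq_setof by set_exists.
Qed.

Ltac read_named ::= eapply reads_pair.

Lemma reads_pair_in e d x y f X Y F :
  names e d x X -> names e d y Y -> names e d f F ->
  reads e d (pair_in x y f) (pair X Y ∊ F).
Proof.
  unfold pair_in. read. split; [now intros (p & -> & Hp)|eauto].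
Qed.

Ltac read_named ::= first [ eapply reads_pair | eapply reads_pair_in ].

Lemma reads_FUNC e d f F : names e d f F -> reads e d (FUNC f) (func F).
Proof. unfold FUNC. read. reflexivity. Qed.

Lemma reads_Ap e d a f x A F X :
  names e d a A -> names e d f F -> names e d x X ->
  reads e d (is_Ap a f x) (A = ap F X).
Proof.
  unfold is_Ap. read. unfold ap. now rewrite eq_setof by set_exists.
Qed.

Lemma reads_id e d i I : names e d i I -> reads e d (is_id i) (I = idset).
Proof.
  unfold is_id. read. unfold idset. now rewrite eq_setof by set_exists.
Qed.

Ltac read_named ::=
  first [ eapply reads_pair | eapply reads_pair_in | eapply reads_FUNC
        | eapply reads_Ap | eapply reads_id ].

Lemma reads_zero e d o O : names e d o O -> reads e d (is_zero o) (O = zero).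
Proof.
  unfold is_zero. read. unfold zero. rewrite eq_setof by set_exists.
  split; intros Eu u; rewrite Eu; split.
  - intros (f & i & -> & ->). eauto.
  - intros (f & ->). eauto.
  - intros (f & ->). eauto.
  - intros (f & i & -> & ->). eauto.
Qed.

Lemma reads_succ_of e d s z A Z :
  names e d s A -> names e d z Z -> reads e d (is_succ_of s z) (A = succ Z).
Proof.
  unfold is_succ_of. read. unfold succ. rewrite eq_setof by set_exists.
  (* The inner description of [p] is recognized as equality to a term, so that [p] can be
     eliminated. *)
  assert (E : forall f p, p = step f Z <-> forall u, u ∊ p <->
    exists x w t q, u = pair x w /\ func t /\ pair f t ∊ Z /\ pair x q ∊ t /\
                    pair q w ∊ f).
  { intros f p. unfold step. now rewrite eq_setof by set_exists. }
  setoid_rewrite <- E.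
  split; intros Ev v; rewrite Ev; split.
  - intros (f & p & -> & Hf & ->). eauto.
  - intros (f & -> & Hf). eauto.
  - intros (f & -> & Hf). eauto.
  - intros (f & p & -> & Hf & ->). eauto.
Qed.

Ltac read_named ::=
  first [ eapply reads_pair | eapply reads_pair_in | eapply reads_FUNC
        | eapply reads_Ap | eapply reads_zero | eapply reads_succ_of ].

Lemma reads_Succ e d s A : names e d s A -> reads e d (is_Succ s) (A = Succ).
Proof.
  unfold is_Succ. read. unfold Succ. rewrite eq_setof by set_exists.
  split; intros Ev v; rewrite Ev; split.
  - intros (z & s' & -> & Hz & ->). eauto.
  - intros (z & -> & Hz). eauto.
  - intros (z & -> & Hz). eauto.
  - intros (z & s' & -> & Hz & ->). eauto.
Qed.

Ltac read_named ::=
  first [ eapply reads_pair | eapply reads_pair_in | eapply reads_FUNC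
        | eapply reads_Ap | eapply reads_zero | eapply reads_Succ ].

Lemma reads_contains_zero e d x X :
  names e d x X -> reads e d (contains_zero x) (zero ∊ X).
Proof.
  unfold contains_zero. read. split; [now intros (o & -> & Ho)|eauto].
Qed.

Lemma reads_closed_under_succ e d x X :
  names e d x X ->
  reads e d (closed_under_succ x) (forall m, m ∊ X -> ap Succ m ∊ X).
Proof.
  unfold closed_under_succ. read. split; intros F m Hm.
  - destruct (F m Hm) as (s & a & -> & -> & Ha). exact Ha.
  - exists Succ, (ap Succ m). auto.
Qed.

Ltac read_named ::=
  first [ eapply reads_contains_zero | eapply reads_closed_under_succ ].

Lemma reads_Nat e d n A : names e d n A -> reads e d (is_Nat n) (A = Nat).
Proof.
  unfold is_Nat. read. unfold Nat. now rewrite eq_setof by set_exists.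
Qed.

Ltac read_named ::=
  first [ eapply reads_pair | eapply reads_pair_in | eapply reads_FUNC
        | eapply reads_Ap | eapply reads_Succ | eapply reads_Nat ].

Definition infinite_set (X : M) : Prop :=
  exists Y, incl_set Y X /\ Y <> X /\
    exists r,
      (forall u, u ∊ r -> exists x y, u = pair x y /\ x ∊ X /\ y ∊ Y) /\
      func r /\
      (forall x, x ∊ X -> exists y, pair x y ∊ r) /\
      (forall x x' y, pair x y ∊ r -> pair x' y ∊ r -> x = x') /\
      (forall y, y ∊ Y -> exists x, pair x y ∊ r).

Lemma reads_infinite e d x X :
  names e d x X -> reads e d (infinite x) (infinite_set X).
Proof.
  unfold infinite, subset, similar, bijection. read. reflexivity.
Qed.

Lemma reads_one_to_one_on e d s x A X :
  names e d s A -> names e d x X ->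
  reads e d (one_to_one_on s x)
    (forall m n, m ∊ X /\ n ∊ X -> (exists a, a = ap A m /\ a = ap A n) ->
                 m = n).
Proof. unfold one_to_one_on. read. reflexivity. Qed.

Ltac read_named ::=
  first [ eapply reads_Succ | eapply reads_Nat | eapply reads_infinite
        | eapply reads_one_to_one_on ].

(** Successor maps N one-to-one onto its range there, which lacks zero. *)
Lemma infinite_Nat : infinite_set Nat.
Proof.
  assert (isset (fun y => exists n, n ∊ Nat /\ y = succ n)) as [Y HY]
    by set_exists.
  exists Y. split; [|split].
  - intros y. rewrite HY. intros (n & Hn & ->). now apply succ_Nat.
  - intros ->. destruct (proj1 (HY zero) zero_Nat) as (n & Hn & E).
    now apply (zero_not_succ n).
  - assert (isset (fun u => exists n, n ∊ Nat /\ u = pair n (succ n))) as [r Hr]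
      by set_exists.
    assert (Hp : forall x y, pair x y ∊ r <-> x ∊ Nat /\ y = succ x).
    { intros x y. rewrite Hr. split; [|intros [Hx ->]; eauto].
      now intros (n & Hn & [-> ->]%pair_inj). }
    exists r. setoid_rewrite Hp.
    split; [|split; [|split; [|split]]].
    + intros u Hu. apply Hr in Hu as (n & Hn & ->). exists n, (succ n).
      rewrite HY. eauto.
    + intros x y z. rewrite !Hp. intros [_ ->] [_ ->]. reflexivity.
    + eauto.
    + intros x x' y [Hx ->] [Hx' E]. now apply succ_inj.
    + intros y Hy. apply HY in Hy as (n & Hn & ->). eauto.
Qed.

Lemma sat_Nat_infinite_and_Succ_one_to_one e :
  sat mem e Nat_infinite_and_Succ_one_to_one.
Proof.
  assert (H : reads e 0
    (∃ N S, is_Nat N ∧ is_Succ S ∧ infinite N ∧ one_to_one_on S N) True);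
    [|now apply H].
  read. split; [auto|]. intros _.
  exists Nat, Succ. split; [reflexivity|]. split; [reflexivity|].
  split; [apply infinite_Nat|].
  intros m n [Hm Hn] (a & -> & E).
  rewrite !ap_Succ in E by now apply Nat_func. now apply succ_inj.
Qed.
End Model.

Theorem corollary20p12 : proves NF Nat_infinite_and_Succ_one_to_one.
Proof.
  apply completeness; [reflexivity|]. intros M mem HNF e.
  assert (ext : forall x y, (forall z, mem z x <-> mem z y) -> x = y).
  { intros x y H. refine (HNF _ e NF_ext x y _). intros z. cbn.
    specialize (H z). tauto. }
  apply (sat_Nat_infinite_and_Succ_one_to_one mem ext); [|exact (e 0)].
  intros p s e' Hs. apply NNPP. intros N.
  (* The axiom begins with [Ex], a negated universal, so it is used by refuting every candidate
     [X]. *)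
  refine (HNF _ e' (NF_comp p (ex_intro _ s Hs)) _). intros X HX. apply N.
  exists X. intros x. specialize (HX x). cbn in HX. rewrite sat_ren in HX.
  (* The renaming in [comprehension] skips the variable that stands for the set. *)
  rewrite (sat_ext _ (scons x e')
             (fun n => scons x (scons X e') (scons 0 (fun n => S (S n)) n)))
    by now intros [|n].
  tauto.
Qed.
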